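(* Let $\mathbb{K}$ be an infinite field and let $(d_n)_{n\in\mathbb{N}}$ be a sequence of positive integers with $d_n\le n^2$ for all $n$ and $\liminf_{n\to\infty}\frac{d_n}{n^2}>\frac{3-\sqrt5}{2}$. Then for any sufficiently large $n$, a generic quadratic $\mathbb{K}$-algebra with $n$ generators and $d_n$ relations has Hilbert series $$1+nt+(n^2-d_n)t^2+\max\{0,\,n^3-2nd_n\}\,t^3=\left|(1-nt+d_nt^2)^{-1}\right|.$$
   Context: A quadratic $\mathbb{K}$-algebra with $n$ generators and $d$ relations is $R=\mathbb{K}\langle x_1,\dots,x_n\rangle/I$, where all generators $x_i$ have degree $1$, and $I$ is the two-sided ideal generated by $d$ linearly independent homogeneous elements $f_j=\sum_{k,m=1}^n c_{j,k,m}x_kx_m$, $1\le j\le d$, $c_{j,k,m}\in\mathbb{K}$. It is graded, $R=\bigoplus_{q\ge 0}R_q$, and its Hilbert series is $H_R(t)=\sum_{q\ge0}(\dim_{\mathbb{K}}R_q)t^q$. ''A generic quadratic $\mathbb{K}$-algebra with $n$ generators and $d$ relations has property $\mathcal{P}$'' means: the set of coefficient vectors $(c_{j,k,m})\in\mathbb{K}^{n^2d}$ for which the corresponding algebra $R$ has property $\mathcal{P}$ contains a dense Zariski open subset of $\mathbb{K}^{n^2d}$. For a formal power series $a(t)=\sum_{j\ge 0}a_jt^j$ with real coefficients, $|a(t)|$ denotes the series obtained from $a(t)$ by replacing all coefficients, starting from the first negative one, by zeros. *)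

(* Defs.v *)
From HB Require Import structures.
From mathcomp Require Import all_boot all_order all_algebra.
From mathcomp Require Import all_classical all_reals all_analysis.
(* The notations of multinomials clash with those of mathcomp-analysis. *)
From mathcomp Require Import -(notations) mpoly monalg.

Set Implicit Arguments.
Unset Strict Implicit.
Unset Printing Implicit Defensive.

Import Order.TTheory GRing.Theory Num.Theory.
Import numFieldNormedType.Exports.

Local Open Scope classical_set_scope.
Local Open Scope ring_scope.
Local Open Scope quotient_scope.

Section FreeAlgebra.
Variables (K : fieldType) (n : nat).

(* Finitely supported functions from words in 'I_n to K. *)
Definition free_alg := monalg.malg (fmonom 'I_n) K.

HB.instance Definition _ := GRing.Lalgebra.on free_alg.

Definition fvar (i : 'I_n) : free_alg := mkmalgU (fmu i) 1.

Definition homogeneous (q : nat) : set free_alg :=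
  [set w | forall m : fmonom 'I_n, monalg.mcoeff m w != 0 -> fdeg m = q].

Lemma free_alg_scaleAr (a : K) (x y : free_alg) : a *: (x * y) = x * (a *: y).
Proof.
have aC (z : free_alg) : mkmalgU (mone : fmonom 'I_n) a * z
    = z * mkmalgU (mone : fmonom 'I_n) a.
  apply/malgP => k; rewrite monalg.mul_malgC.
  rewrite (monalg.malgM_def z) monalg.fgmulgU.
  rewrite {1}(monalg.monalgE z) scaler_sumr !raddf_sum /=.
  apply: eq_bigr => i _.
  by rewrite monalg.mcoeffZ !monalg.mcoeffU mulm1 mulrnAr mulrC.
by rewrite -!monalg.mul_malgC !mulrA aC.
Qed.

HB.instance Definition _ := GRing.Lalgebra_isAlgebra.Build K free_alg
  free_alg_scaleAr.

End FreeAlgebra.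

Section QuadraticAlgebra.
Variables (K : fieldType) (n d : nat).
Variable c : 'I_d * 'I_n * 'I_n -> K.

Local Notation F := (free_alg K n).

Definition quad_rel (j : 'I_d) : F :=
  \sum_(k < n) \sum_(m < n) c (j, k, m) *: (fvar K k * fvar K m).

Definition quad_rel_free : Prop :=
  forall a : 'I_d -> K, \sum_j a j *: quad_rel j = 0 -> forall j, a j = 0.

(* Two-sided ideal generated by the [quad_rel j]. *)
Definition rel_ideal : {pred F} := fun w =>
  `[< exists s : seq (F * 'I_d * F),
        w = \sum_(t <- s) t.1.1 * quad_rel t.1.2 * t.2 >].

Lemma rel_idealP w : reflect
  (exists s : seq (F * 'I_d * F),
     w = \sum_(t <- s) t.1.1 * quad_rel t.1.2 * t.2) (w \in rel_ideal).
Proof. exact: asboolP. Qed.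

Lemma rel_ideal_Ml x w : w \in rel_ideal -> x * w \in rel_ideal.
Proof.
move=> /rel_idealP[s ->]; apply/rel_idealP.
exists [seq (x * t.1.1, t.1.2, t.2) | t <- s].
by rewrite big_map mulr_sumr; apply: eq_bigr => t _; rewrite !mulrA.
Qed.

Lemma rel_ideal_Mr x w : w \in rel_ideal -> w * x \in rel_ideal.
Proof.
move=> /rel_idealP[s ->]; apply/rel_idealP.
exists [seq (t.1.1, t.1.2, t.2 * x) | t <- s].
by rewrite big_map mulr_suml; apply: eq_bigr => t _; rewrite !mulrA.
Qed.

Lemma rel_ideal_Z a w : w \in rel_ideal -> a *: w \in rel_ideal.
Proof. by rewrite -[a *: w]mulr_algl; apply: rel_ideal_Ml. Qed.

Lemma rel_ideal_zmod : zmod_closed rel_ideal.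
Proof.
split=> [|u v /rel_idealP[s ->]].
  by apply/rel_idealP; exists [::]; rewrite big_nil.
move=> /(rel_ideal_Z (-1)); rewrite scaleN1r => /rel_idealP[t ->].
by apply/rel_idealP; exists (s ++ t); rewrite big_cat.
Qed.

HB.instance Definition _ := GRing.isZmodClosed.Build F rel_ideal rel_ideal_zmod.

Lemma rel_ideal_1 : 1 \notin rel_ideal.
Proof.
apply/negP => /rel_idealP[s] /(congr1 (monalg.mcoeff mone)).
rewrite raddf_sum /= big1 => [/eqP|t _]; first by rewrite rmorph1 oner_eq0.
rewrite !rmorphM /= [X in _ * X * _](_ : _ = 0) ?mulr0 ?mul0r//.
rewrite raddf_sum big1// => k _; rewrite raddf_sum big1// => m _ /=.
rewrite monalg.mcoeffZ rmorphM /= monalg.mcoeffU.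
by rewrite -fdeg_eq0 fdegU /= mulr0n mul0r mulr0.
Qed.

(* ring_quotient only provides the additive structure of the quotient by a
   two-sided ideal of a noncommutative ring. *)
Definition quad_alg : Type := Quotient.quot rel_ideal.

HB.instance Definition _ := GRing.Zmodule.on quad_alg.
HB.instance Definition _ : EqQuotient F (Quotient.equiv rel_ideal) quad_alg :=
  EqQuotient.on quad_alg.

Definition quad_proj (w : F) : quad_alg := \pi_(Quotient.quot rel_ideal) w.

Lemma quad_projP u v : reflect (quad_proj u = quad_proj v) (u - v \in rel_ideal).
Proof. by rewrite Quotient.idealrBE; apply: eqP. Qed.

Lemma quad_projK (x : quad_alg) : quad_proj (repr x) = x.
Proof. exact: reprK. Qed.

Lemma quad_projD : {morph quad_proj : u v / u + v}.
Proof. by move=> u v; rewrite /quad_proj !piE. Qed.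

Definition quad_one : quad_alg := quad_proj 1.
Definition quad_mul (x y : quad_alg) := quad_proj (repr x * repr y).
Definition quad_scale (a : K) (x : quad_alg) := quad_proj (a *: repr x).

Lemma repr_quad_proj u : repr (quad_proj u) - u \in rel_ideal.
Proof. by apply/quad_projP; rewrite quad_projK. Qed.

Lemma quad_projM u v : quad_mul (quad_proj u) (quad_proj v) = quad_proj (u * v).
Proof.
apply/quad_projP; set u' := repr _; set v' := repr _.
have -> : u' * v' - u * v = (u' - u) * v' + u * (v' - v).
  by rewrite mulrBl mulrBr addrA subrK.
by apply: rpredD; [apply: rel_ideal_Mr | apply: rel_ideal_Ml];
  apply: repr_quad_proj.
Qed.

Lemma quad_projZ a u : quad_scale a (quad_proj u) = quad_proj (a *: u).
Proof.
by apply/quad_projP; rewrite -scalerBr; apply/rel_ideal_Z/repr_quad_proj.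
Qed.

Lemma quad_ind (P : quad_alg -> Prop) :
  (forall u, P (quad_proj u)) -> forall x, P x.
Proof. by move=> PF x; rewrite -(quad_projK x). Qed.

Fact quad_mulA : associative quad_mul.
Proof.
move=> x y z; elim/quad_ind: x => u; elim/quad_ind: y => v.
elim/quad_ind: z => w.
by rewrite !quad_projM mulrA.
Qed.

Fact quad_mul1 : left_id quad_one quad_mul.
Proof. by move=> x; elim/quad_ind: x => u; rewrite quad_projM mul1r. Qed.

Fact quad_mulr1 : right_id quad_one quad_mul.
Proof. by move=> x; elim/quad_ind: x => u; rewrite quad_projM mulr1. Qed.

Fact quad_mulDl : left_distributive quad_mul +%R.
Proof.
move=> x y z; elim/quad_ind: x => u; elim/quad_ind: y => v.
elim/quad_ind: z => w.
by rewrite !quad_projM -!quad_projD quad_projM mulrDl.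
Qed.

Fact quad_mulDr : right_distributive quad_mul +%R.
Proof.
move=> x y z; elim/quad_ind: x => u; elim/quad_ind: y => v.
elim/quad_ind: z => w.
by rewrite !quad_projM -!quad_projD quad_projM mulrDr.
Qed.

Fact quad_one_neq0 : quad_one != 0.
Proof.
have -> : 0 = quad_proj 0 by rewrite /quad_proj !piE.
by apply/eqP => /quad_projP; apply/negP; rewrite subr0 rel_ideal_1.
Qed.

HB.instance Definition _ := GRing.Zmodule_isNzRing.Build quad_alg
  quad_mulA quad_mul1 quad_mulr1 quad_mulDl quad_mulDr quad_one_neq0.

Fact quad_scaleA a b x : quad_scale a (quad_scale b x) = quad_scale (a * b) x.
Proof. by elim/quad_ind: x => u; rewrite !quad_projZ scalerA. Qed.

Fact quad_scale1 : left_id 1 quad_scale.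
Proof. by move=> x; elim/quad_ind: x => u; rewrite quad_projZ scale1r. Qed.

Fact quad_scaleDr : right_distributive quad_scale +%R.
Proof.
move=> a x y; elim/quad_ind: x => u; elim/quad_ind: y => v.
by rewrite -quad_projD !quad_projZ scalerDr quad_projD.
Qed.

Fact quad_scaleDl x : {morph quad_scale^~ x : a b / a + b}.
Proof.
by elim/quad_ind: x => u a b; rewrite !quad_projZ scalerDl quad_projD.
Qed.

HB.instance Definition _ := GRing.Zmodule_isLmodule.Build K quad_alg
  quad_scaleA quad_scale1 quad_scaleDr quad_scaleDl.

Fact quad_scaleAl (a : K) (x y : quad_alg) : a *: (x * y) = (a *: x) * y.
Proof.
elim/quad_ind: x => u; elim/quad_ind: y => v; rewrite /GRing.scale /GRing.mul /=.
by rewrite quad_projM !quad_projZ quad_projM scalerAl.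
Qed.

HB.instance Definition _ := GRing.Lmodule_isLalgebra.Build K quad_alg
  quad_scaleAl.

Fact quad_scaleAr (a : K) (x y : quad_alg) : a *: (x * y) = x * (a *: y).
Proof.
elim/quad_ind: x => u; elim/quad_ind: y => v; rewrite /GRing.scale /GRing.mul /=.
by rewrite quad_projM !quad_projZ quad_projM scalerAr.
Qed.

HB.instance Definition _ := GRing.Lalgebra_isAlgebra.Build K quad_alg
  quad_scaleAr.

Definition quad_comp (q : nat) : set quad_alg := quad_proj @` homogeneous q.

End QuadraticAlgebra.

Arguments quad_comp {K n d} c q _.

(* The subset S of V is a subspace with a basis of m elements. *)
Definition has_dim (K : fieldType) (V : lmodType K) (S : set V) (m : nat) :=
  exists b : 'I_m -> V,
    (forall a : 'I_m -> K, \sum_i a i *: b i = 0 -> forall i, a i = 0) /\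
    S = [set \sum_i a i *: b i | a in [set: 'I_m -> K]].

(* The Hilbert series of quad_alg c exists and is \sum_q h q t^q. *)
Definition is_hilbert_series (R : realType) (K : fieldType) (n d : nat)
    (c : 'I_d * 'I_n * 'I_n -> K) (h : nat -> R) :=
  forall q, exists2 m, has_dim (quad_comp c q) m & h q = m%:R.

Section Zariski.
Variables (K : fieldType) (T : finType).

(* Points of the affine space K^T; variable i of a polynomial is the
   coordinate indexed by the i-th element of T. *)
Definition zariski_closed (Z : set (T -> K)) :=
  exists S : set (mpoly #|T| K),
    Z = [set v | forall p, S p -> meval (fun i => v (enum_val i)) p = 0].

Definition zariski_open (U : set (T -> K)) := zariski_closed (~` U).

Definition zariski_dense (U : set (T -> K)) :=
  forall O, O !=set0 -> zariski_open O -> O `&` U !=set0.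

End Zariski.

(* A coefficient vector c presents a quadratic algebra with n generators and d
   relations only when its relations are linearly independent. *)
Definition generic_quadratic (K : fieldType) (n d : nat)
    (P : ('I_d * 'I_n * 'I_n -> K) -> Prop) :=
  exists U : set ('I_d * 'I_n * 'I_n -> K),
    [/\ zariski_open U, zariski_dense U
      & U `<=` [set c | quad_rel_free c /\ P c]].

Section PowerSeries.
Variable R : realType.
Implicit Types a b : nat -> R.

Definition ps_of_poly (p : {poly R}) : nat -> R := fun k => p`_k.

Definition ps_mul a b : nat -> R := fun k => \sum_(i < k.+1) a i * b (k - i)%N.

(* Initial segment of length k of the multiplicative inverse, from
   a_0 b_k = [k = 0] - \sum_(i < k) a_(k-i) b_i. *)
Fixpoint ps_inv_seq a (k : nat) : seq R :=
  if k is k'.+1 then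
    let s := ps_inv_seq a k' in
    rcons s ((a 0)^-1 * ((k' == 0)%:R - \sum_(i < k') a (k' - i)%N * s`_i))
  else [::].

Definition ps_inv a : nat -> R := fun k => (ps_inv_seq a k.+1)`_k.

Lemma size_ps_inv_seq a k : size (ps_inv_seq a k) = k.
Proof. by elim: k => //= k IH; rewrite size_rcons IH. Qed.

Lemma nth_ps_inv_seq a k i : (i < k)%N -> (ps_inv_seq a k)`_i = ps_inv a i.
Proof.
elim: k => // k IH; rewrite ltnS leq_eqVlt => /predU1P[->//|ik].
by rewrite /= nth_rcons size_ps_inv_seq ik IH.
Qed.

Lemma ps_invE a k : ps_inv a k =
  (a 0)^-1 * ((k == 0)%:R - \sum_(i < k) a (k - i)%N * ps_inv a i).
Proof.
rewrite {1}/ps_inv /= nth_rcons size_ps_inv_seq ltnn eqxx.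
by congr (_ * (_ - _)); apply: eq_bigr => i _; rewrite nth_ps_inv_seq.
Qed.

Lemma ps_mulV a : a 0 != 0 -> ps_mul a (ps_inv a) = ps_of_poly 1.
Proof.
move=> a0; apply/funext => k; rewrite /ps_of_poly coef1 /ps_mul.
rewrite (reindex_inj rev_ord_inj) big_ord_recr /= subSS subnn subn0.
rewrite [X in _ + _ * X]ps_invE mulVKf // addrC -addrA -[RHS]addr0; congr (_ + _).
apply/eqP; rewrite addrC subr_eq0; apply/eqP; apply: eq_bigr => i _.
by rewrite subSS subKn // ltnW.
Qed.

(* |a(t)| *)
Definition ps_trunc a : nat -> R := fun k =>
  if [forall i : 'I_k.+1, 0 <= a i] then a k else 0.

End PowerSeries.

(* Main.v *)
From HB Require Import structures.
Require Import Defs.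
From mathcomp Require Import all_boot all_order all_algebra.
From mathcomp Require Import all_classical all_reals all_analysis.
From mathcomp Require Import -(notations) mpoly monalg.
From mathcomp Require Import zify ring lra.

Set Implicit Arguments.
Unset Strict Implicit.
Unset Printing Implicit Defensive.

Import Order.TTheory GRing.Theory Num.Theory.
Import numFieldNormedType.Exports.

Local Open Scope classical_set_scope.
Local Open Scope ring_scope.

(** Why the theorem holds.  Write I_q for the degree q part of the ideal of
    relations, so that dim R_q = n^q - dim I_q, and b for the number
    (3 - sqrt 5) / 2, the root of b^2 - 3 b + 1 = 0 in the unit interval; it
    also satisfies (1 - b)^2 = b.

    Shape of the series.  The inverse of 1 - n t + d t^2 begins with 1, n,
    n^2 - d, n^3 - 2 n d, n^4 - 3 n^2 d + d^2, and the last number is negative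
    as soon as d > b n^2 and n^3 - 2 n d >= 0.  Hence the truncation stops at
    degree 3 at the latest ([ps_trunc_inv_quadratic]).

    Genericity.  dim I_q is the rank of a matrix [ideal_mx] whose entries are
    linear in the coefficients of the relations, and a lower bound on the rank
    of such a matrix is a Zariski open condition ([zariski_open_rank_ge]).
    The series is the expected one as soon as three ranks are maximal:
    degree 2 (the relations are independent), degree 3 (the rank is
    min (n^3, 2 n d)) and degree 4 (the rank is n^4; then R_q = 0 for all
    q >= 4).  Over an infinite field nonempty open sets meet
    ([zariski_open_meet]): restricted to the line through a point of each, the
    defining polynomials become nonzero polynomials in one variable.  So three
    unrelated examples suffice, one for each degree
    ([generic_hilbert_series]).

    Degree 3.  Take letters x_i, y_i and the relations x_i y_j and
    x_i x_j - y_i y_j.  They kill every word of length 3, and there are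
    n^2 / 2 of them.  If n is odd, add a letter z with relations
    x_i z - z (x_i + y_i), y_i z - z y_i: now the n words z z u span
    degree 3, and they die if the relation z z is added.  In both cases this is
    the best possible count.  Removing a relation removes 2 n rows of the
    matrix, so fewer relations still give independent rows
    ([cubic_rank_example]).

    Degree 4.  This is where b enters.  Consider words x y z u with letters
    from four sets of size m, subject to one space of relations for the pairs
    x y and z u, and another one for y z.  For the outer pairs let all words
    p q with q - p in {0, ..., s - 1} modulo m be relations.  Given x and u,
    there remain (m - s)^2 pairs y z, in varying position; m s generic
    relations on the pairs y z (here: a Vandermonde system) kill them all once
    (m - s)^2 <= m s, that is, s / m >= b.  To pass to a single set of
    relations, colour the letters with k colours, let the relations respect
    colours, and kill all pairs of letters of the same colour; the last step
    costs only n^2 / k relations.  In any other coloured word the middle pair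
    of colours differs from the outer pairs, so the choice above can be made
    for this word, and genericity in the coefficients of coloured relations
    serves all words at once ([good_color_proper],
    [colored_quartic_example]).  With k large and s / m close to b this uses
    at most (b + e) n^2 relations for large n ([quartic_parameters]). *)

(** * Zariski open sets of coefficient vectors *)

Section Generic.
Variables (K : fieldType) (T : finType).
Implicit Types (U : set (T -> K)) (v : T -> K).

Definition poly_fun (f : (T -> K) -> K) :=
  exists p : mpoly #|T| K, forall v, f v = meval (fun i => v (enum_val i)) p.

Lemma poly_fun_const a : poly_fun (fun=> a).
Proof. by exists (mpolyC _ a) => v; rewrite mevalC. Qed.

Lemma poly_fun_coord t : poly_fun (fun v => v t).
Proof.
exists (mpolyX K (mnm1 (enum_rank t))) => v.
by rewrite mevalXU enum_rankK.
Qed.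

Lemma poly_funM f g : poly_fun f -> poly_fun g -> poly_fun (fun v => f v * g v).
Proof. by move=> [p fp] [q gq]; exists (p * q) => v; rewrite mevalM fp gq. Qed.

Lemma poly_fun_sum (I : Type) (r : seq I) (P : pred I) (F : I -> (T -> K) -> K) :
  (forall i, P i -> poly_fun (F i)) ->
  poly_fun (fun v => \sum_(i <- r | P i) F i v).
Proof.
move=> FP; elim: r => [|i r [p ihp]].
  by have [p p0] := poly_fun_const 0; exists p => v; rewrite big_nil -p0.
have [Pi|nPi] := boolP (P i); last first.
  by exists p => v; rewrite big_cons (negbTE nPi) ihp.
have [q fq] := FP _ Pi.
by exists (q + p) => v; rewrite big_cons Pi mevalD ihp fq.
Qed.

Lemma poly_fun_prod (I : Type) (r : seq I) (P : pred I) (F : I -> (T -> K) -> K) :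
  (forall i, P i -> poly_fun (F i)) ->
  poly_fun (fun v => \prod_(i <- r | P i) F i v).
Proof.
move=> FP; elim: r => [|i r [p ihp]].
  by have [p p0] := poly_fun_const 1; exists p => v; rewrite big_nil -p0.
have [Pi|nPi] := boolP (P i); last first.
  by exists p => v; rewrite big_cons (negbTE nPi) ihp.
have [q fq] := FP _ Pi.
by exists (q * p) => v; rewrite big_cons Pi mevalM ihp fq.
Qed.

Definition poly_mx m n (M : (T -> K) -> 'M[K]_(m, n)) :=
  forall i j, poly_fun (fun v => M v i j).

Lemma poly_mx_const m n (A : 'M[K]_(m, n)) : poly_mx (fun=> A).
Proof. by move=> i j; apply: poly_fun_const. Qed.

Lemma poly_mx_mul m n p (M : (T -> K) -> 'M[K]_(m, n)) (N : (T -> K) -> 'M[K]_(n, p)) :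
  poly_mx M -> poly_mx N -> poly_mx (fun v => M v *m N v).
Proof.
move=> PM PN i j; have [p0 Hp] : poly_fun (fun v => \sum_k M v i k * N v k j).
  by apply: poly_fun_sum => k _; apply: poly_funM.
by exists p0 => v; rewrite mxE Hp.
Qed.

Lemma poly_fun_det n (M : (T -> K) -> 'M[K]_n) :
  poly_mx M -> poly_fun (fun v => \det (M v)).
Proof.
move=> PM; apply: poly_fun_sum => s _; apply: poly_funM.
  exact: poly_fun_const.
by apply: poly_fun_prod => i _; apply: PM.
Qed.

(** The form in which all open sets below arise: unions of non-vanishing loci,
    indexed by a type that may be infinite. *)
Lemma zariski_open_nonvanishing U (I : Type) (f : I -> (T -> K) -> K) :
  (forall i, poly_fun (f i)) -> (forall v, U v <-> exists i, f i v != 0) ->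
  zariski_open U.
Proof.
move=> fP UP.
exists [set p | exists i, forall v, f i v = meval (fun i => v (enum_val i)) p].
apply/seteqP; split=> v /=.
  move=> nUv p [i fip]; rewrite -fip; apply: contra_notP nUv => /eqP fi0.
  by apply/UP; exists i.
move=> vanish /UP[i]; have [p fip] := fP i.
by rewrite fip vanish ?eqxx//; exists i.
Qed.

(** Determinants of [X *m A *m Y] with constant [X] and [Y] detect the rank as
    well as minors do; no choice of rows and columns is needed to define them. *)
Lemma rank_ge_det m n (A : 'M[K]_(m, n)) r :
  (r <= \rank A)%N <->
  exists XY : 'M[K]_(r, m) * 'M[K]_(n, r), \det (XY.1 *m A *m XY.2) != 0.
Proof.
split=> [rA|[[X Y] /= XAY]]; last first.
  have: \rank (X *m A *m Y) = r.
    by apply: mxrank_unit; rewrite unitmxE unitfE.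
  by move=> <-; apply: leq_trans (mxrankM_maxl _ _) (mxrankM_maxr _ _).
exists (pid_mx r *m invmx (col_ebase A), invmx (row_ebase A) *m pid_mx r) => /=.
set XAY := (X in \det X); suff -> : XAY = 1%:M by rewrite det1 oner_neq0.
rewrite {}/XAY; move: (mulmx_ebase A) (row_ebase_unit A) (col_ebase_unit A).
move: (row_ebase A) (col_ebase A) => V U AE Vu Uu.
rewrite -[X in _ *m X *m _]AE -!mulmxA mulKVmx // mulKmx // !mul_pid_mx.
rewrite -[RHS]pid_mx_1; congr pid_mx.
by have := rank_leq_col A; have := rank_leq_row A; lia.
Qed.

Lemma zariski_open_rank_ge m n (M : (T -> K) -> 'M[K]_(m, n)) r :
  poly_mx M -> zariski_open [set v | (r <= \rank (M v))%N].
Proof.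
move=> PM; pose f (XY : 'M[K]_(r, m) * 'M[K]_(n, r)) v :=
  \det (XY.1 *m M v *m XY.2).
apply: (@zariski_open_nonvanishing _ _ f) => [[X Y]|v]; last exact: rank_ge_det.
by apply/poly_fun_det/poly_mx_mul/poly_mx_const/poly_mx_mul; first exact: poly_mx_const.
Qed.

Lemma zariski_openT : zariski_open [set: T -> K].
Proof.
apply: (@zariski_open_nonvanishing _ unit (fun=> fun=> 1)) => [_|v].
  exact: poly_fun_const.
by split=> // _; exists tt; exact: oner_neq0.
Qed.

Lemma zariski_openP U : zariski_open U -> exists S : set (mpoly #|T| K),
  forall v, U v <-> exists2 p, S p & meval (fun i => v (enum_val i)) p != 0.
Proof.
move=> [S US]; exists S => v.
have -> : U v = ~ (~` U) v by apply/propext; rewrite /setC /= notK.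
rewrite US /=; split=> [|[p Sp pv] /(_ p Sp)]; last exact/eqP.
move=> nS; apply: contrapT => nex; apply: nS => p Sp; apply: contrapT => /eqP pv.
by apply: nex; exists p.
Qed.

Lemma zariski_openI U U' :
  zariski_open U -> zariski_open U' -> zariski_open (U `&` U').
Proof.
move=> /zariski_openP[S SP] /zariski_openP[S' SP'].
pose f (p : {p | S p} * {p | S' p}) (v : T -> K) :=
  meval (fun i => v (enum_val i)) (sval p.1 * sval p.2).
apply: (@zariski_open_nonvanishing _ _ f) => [p|v]; first by eexists.
split=> [[/SP[p Sp pv] /SP'[q Sq qv]]|[[[p Sp] [q Sq]]]].
  by exists (exist _ p Sp, exist _ q Sq); rewrite /f /= mevalM mulf_neq0.
rewrite /f /= mevalM mulf_eq0 negb_or => /andP[pv qv].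
by split; [apply/SP; exists p|apply/SP'; exists q].
Qed.

Lemma meval_line (p : mpoly #|T| K) (v w : T -> K) : exists q : {poly K},
  forall t, q.[t] = meval (fun i => v (enum_val i) + t * w (enum_val i)) p.
Proof.
pose l (i : 'I_#|T|) : {poly K} := (v (enum_val i))%:P + 'X * (w (enum_val i))%:P.
exists (mpoly.mmap (@polyC K) l p) => t.
rewrite /meval /mpoly.mmap horner_sum; apply: eq_bigr => m _.
rewrite hornerM hornerC horner_prod; congr (_ * _); apply: eq_bigr => i _.
by rewrite horner_exp !hornerE.
Qed.

Lemma infinite_uniq_seq N : infinite_set [set: K] ->
  exists2 s : seq K, uniq s & (N <= size s)%N.
Proof.
move=> /(infinite_set_fset N)[B _ BN]; exists (finmap.enum_fset B) => //.
exact: finmap.fset_uniq.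
Qed.

Lemma infinite_nonroot (p : {poly K}) :
  infinite_set [set: K] -> p != 0 -> exists t, p.[t] != 0.
Proof.
move=> /(infinite_uniq_seq (size p))[s us ps] p0; apply: contrapT => nex.
have ps0 : all (root p) s.
  apply/allP => t _; apply/rootP/eqP/negPn/negP => pt; apply: nex.
  by exists t.
by have := max_poly_roots p0 ps0 us; rewrite ltnNge ps.
Qed.

(** Irreducibility of affine space, proved on the line through a point of each
    of the two sets, where only polynomials in one variable occur. *)
Lemma zariski_open_meet U U' : infinite_set [set: K] ->
  zariski_open U -> zariski_open U' -> U !=set0 -> U' !=set0 ->
  U `&` U' !=set0.
Proof.
move=> Kinf /zariski_openP[S SP] /zariski_openP[S' SP'].
move=> [v /SP[p Sp pv]] [w /SP'[q Sq qw]].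
pose u : T -> K := fun t => w t - v t.
have [f fE] := meval_line p v u; have [g gE] := meval_line q v u.
have f0 : f != 0.
  apply: contraNneq pv => f0; have := fE 0; rewrite f0 horner0 => /esym/eqP.
  by under meval_eq do rewrite mul0r addr0.
have g0 : g != 0.
  apply: contraNneq qw => g0; have := gE 1; rewrite g0 horner0 => /esym/eqP.
  by under meval_eq do rewrite mul1r /u addrC subrK.
have [|t] := @infinite_nonroot (f * g) Kinf; first exact: mulf_neq0.
rewrite hornerM mulf_eq0 negb_or fE gE => /andP[pt qt].
by exists (fun x => v x + t * u x); split; [apply/SP; exists p|apply/SP'; exists q].
Qed.

Lemma zariski_open_bigmeet (I : Type) (r : seq I) (F : I -> set (T -> K)) :
  infinite_set [set: K] ->
  (forall i, zariski_open (F i)) -> (forall i, F i !=set0) ->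
  zariski_open (\big[setI/setT]_(i <- r) F i) /\
  \big[setI/setT]_(i <- r) F i !=set0.
Proof.
move=> Kinf Fo Fn; elim: r => [|i r [ro rn]].
  by rewrite big_nil; split; [exact: zariski_openT|exists (fun=> 0)].
rewrite big_cons; split; first exact: zariski_openI.
exact: zariski_open_meet.
Qed.

End Generic.

(** * Hilbert series through ranks *)

Lemma mulr_sum_scale (K : fieldType) (A : algType K) (I J : Type) (rI : seq I)
    (rJ : seq J) (f : I -> K) (g : J -> K) (u : I -> A) (v : J -> A) (x : A) :
  (\sum_(i <- rI) f i *: u i) * x * (\sum_(j <- rJ) g j *: v j) =
  \sum_(i <- rI) \sum_(j <- rJ) (f i * g j) *: (u i * x * v j).
Proof.
rewrite mulr_suml mulr_suml; apply: eq_bigr => i _.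
rewrite mulr_sumr; apply: eq_bigr => j _.
by rewrite -scalerAr -!scalerAl scalerA mulrC.
Qed.

Section HilbertSeries.
Variables (K : fieldType) (n d : nat).
Implicit Types (c : 'I_d * 'I_n * 'I_n -> K) (q : nat).

Local Notation F := (free_alg K n).

Definition word_monom (s : seq 'I_n) : F := mkmalgU (FMonom s) 1.

Lemma word_monom_cat s s' : word_monom (s ++ s') = word_monom s * word_monom s'.
Proof.
rewrite /word_monom monalg.malgM_def monalg.fgmulUU mulr1.
by congr mkmalgU; exact/esym/fmmulE.
Qed.

Definition word_coef (s : seq 'I_n) (x : F) : K := monalg.mcoeff (FMonom s) x.

Lemma word_coef_is_linear s : scalar (word_coef s).
Proof. by move=> a x y; rewrite /word_coef monalg.mcoeffD monalg.mcoeffZ. Qed.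

HB.instance Definition _ s := GRing.isLinear.Build K F K _ (word_coef s)
  (word_coef_is_linear s).

Lemma word_coefE s s' : word_coef s (word_monom s') = (s == s')%:R.
Proof. by rewrite /word_coef monalg.mcoeffU eq_sym. Qed.

Lemma free_alg_word_sum (x : F) :
  x = \sum_(m <- finmap.enum_fset (monalg.msupp x)) word_coef m x *: word_monom m.
Proof.
rewrite [LHS]monalg.monalgE; apply: eq_bigr => m _.
by apply/malgP => k; rewrite monalg.mcoeffZ !monalg.mcoeffU /word_coef fmK mulr_natr.
Qed.

Lemma free_algP (x y : F) : (forall s, word_coef s x = word_coef s y) -> x = y.
Proof. by move=> xy; apply/malgP => m; rewrite -(fmK m); apply: xy. Qed.

Lemma homogeneousP q (x : F) :
  homogeneous q x <-> forall s, word_coef s x != 0 -> size s = q.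
Proof.
split=> [xq s /xq <-|xq m]; first by rewrite fdegE.
by rewrite -{1}(fmK m) => /xq; rewrite fdegE.
Qed.

Local Opaque word_monom word_coef.

Definition insert2 (i : nat) (t : seq 'I_n) (x y : 'I_n) :=
  take i t ++ [:: x, y & drop i t].

Lemma insert2_cat s s' x y :
  insert2 (size s) (s ++ s') x y = s ++ [:: x; y] ++ s'.
Proof. by rewrite /insert2 take_size_cat// drop_size_cat. Qed.

Lemma size_insert2 i t x y : (i <= size t)%N -> size (insert2 i t x y) = (size t).+2.
Proof. by move=> it; rewrite size_cat /= size_takel// size_drop; lia. Qed.

Local Notation placement q := ('I_q.-1 * 'I_d * q.-2.-tuple 'I_n)%type.

(** The row of [(i, j, t)] is the product of the first [i] letters of [t], the
    relation [j], and the remaining letters of [t], so that the row space is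
    the degree [q] part of the ideal.  For [q < 2] there are no rows. *)
Definition ideal_mx c q : 'M[K]_(#|{: placement q}|, #|{: q.-tuple 'I_n}|) :=
  \matrix_(a, b) let p : placement q := enum_val a in
    \sum_x \sum_y c (p.1.2, x, y)
      * (val (enum_val b) == insert2 p.1.1 p.2 x y)%:R.

Definition word_coords q (x : F) : 'rV[K]_#|{: q.-tuple 'I_n}| :=
  \row_b word_coef (val (enum_val b)) x.

Definition of_word_coords q (v : 'rV[K]_#|{: q.-tuple 'I_n}|) : F :=
  \sum_b v 0 b *: word_monom (val (enum_val b)).

Lemma word_coords_is_linear q : linear (@word_coords q).
Proof. by move=> a x y; apply/rowP => b; rewrite !mxE linearP. Qed.

HB.instance Definition _ q := GRing.isLinear.Build K F _ _ (@word_coords q)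
  (@word_coords_is_linear q).

Lemma of_word_coords_is_linear q : linear (@of_word_coords q).
Proof.
move=> a x y; rewrite /of_word_coords scaler_sumr -big_split /=.
by apply: eq_bigr => b _; rewrite !mxE scalerDl scalerA.
Qed.

HB.instance Definition _ q := GRing.isLinear.Build K _ F _ (@of_word_coords q)
  (@of_word_coords_is_linear q).

Lemma word_coef_of_word_coords q (v : 'rV_#|{: q.-tuple 'I_n}|) s :
  word_coef s (of_word_coords v) = \sum_b v 0 b * (s == val (enum_val b))%:R.
Proof.
rewrite /of_word_coords linear_sum; apply: eq_bigr => b _.
by rewrite linearZ /= word_coefE.
Qed.

Lemma of_word_coordsK q : cancel (@of_word_coords q) (@word_coords q).
Proof.
move=> v; apply/rowP => b; rewrite mxE word_coef_of_word_coords (bigD1 b)//=.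
rewrite eqxx mulr1 big1 ?addr0// => b' b'b.
by rewrite (inj_eq val_inj) (inj_eq enum_val_inj) eq_sym (negbTE b'b) mulr0.
Qed.

Lemma homogeneous_of_word_coords q v : homogeneous q (@of_word_coords q v).
Proof.
apply/homogeneousP => s; apply: contra_neq_eq => sq.
rewrite word_coef_of_word_coords big1// => b _.
by case: eqP => [sb|]; [case/eqP: sq; rewrite sb size_tuple|rewrite mulr0].
Qed.

Lemma word_coordsK q x : homogeneous q x -> of_word_coords (word_coords q x) = x.
Proof.
move=> xq; apply: free_algP => s; have [/eqP sq|sq] := eqVneq (size s) q.
  have /rowP/(_ (enum_rank (Tuple sq))) := of_word_coordsK (word_coords q x).
  by rewrite !mxE enum_rankK.
have nonhom y : homogeneous q y -> word_coef s y = 0.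
  by move=> /homogeneousP yq; apply/eqP; apply: contraNT sq => /yq ->.
by rewrite !nonhom//; apply: homogeneous_of_word_coords.
Qed.

Lemma quad_rel_word c j :
  quad_rel c j = \sum_x \sum_y c (j, x, y) *: word_monom [:: x; y].
Proof.
rewrite /quad_rel; apply: eq_bigr => x _; apply: eq_bigr => y _; congr (_ *: _).
by rewrite /fvar !fmuE -(word_monom_cat [:: x] [:: y]).
Qed.

Lemma word_rel_word c j s s' :
  word_monom s * quad_rel c j * word_monom s' =
  \sum_x \sum_y c (j, x, y) *: word_monom (insert2 (size s) (s ++ s') x y).
Proof.
rewrite quad_rel_word mulr_sumr mulr_suml; apply: eq_bigr => x _.
rewrite mulr_sumr mulr_suml; apply: eq_bigr => y _.
by rewrite -scalerAr -scalerAl insert2_cat !word_monom_cat mulrA.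
Qed.

Lemma word_coef_word_rel_word c j s s' w :
  word_coef w (word_monom s * quad_rel c j * word_monom s') =
  \sum_x \sum_y c (j, x, y) * (w == insert2 (size s) (s ++ s') x y)%:R.
Proof.
rewrite word_rel_word linear_sum; apply: eq_bigr => x _.
by rewrite linear_sum; apply: eq_bigr => y _; rewrite linearZ /= word_coefE.
Qed.

Lemma row_ideal_mx c q a : let p : placement q := enum_val a in
  row a (ideal_mx c q) = word_coords q
    (word_monom (take p.1.1 p.2) * quad_rel c p.1.2 * word_monom (drop p.1.1 p.2)).
Proof.
apply/rowP => b; rewrite !mxE word_coef_word_rel_word cat_take_drop.
case: (enum_val a) => [[i j] t] /=; rewrite (_ : size (take i t) = i)//.
by apply: size_takel; rewrite size_tuple; have := ltn_ord i; lia.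
Qed.

Lemma homogeneous_word_rel_word c j s s' :
  homogeneous (size s + size s').+2 (word_monom s * quad_rel c j * word_monom s').
Proof.
apply/homogeneousP => w; apply: contra_neq_eq => mq.
rewrite word_coef_word_rel_word big1// => x _; rewrite big1// => y _.
case: eqP => [mb|]; last by rewrite mulr0.
case/eqP: mq; rewrite mb insert2_cat.
by rewrite size_cat /= !addnS.
Qed.

Lemma of_word_coords_ideal c q v :
  (v <= ideal_mx c q)%MS -> of_word_coords v \in rel_ideal c.
Proof.
move=> /submxP[u ->]; rewrite mulmx_sum_row linear_sum rpred_sum// => a _.
rewrite linearZ /=; apply: rel_ideal_Z; rewrite row_ideal_mx.
case: (enum_val a) => [[i j] t] /=; rewrite word_coordsK.
  apply: rel_ideal_Mr; apply: rel_ideal_Ml; apply/rel_idealP; exists [:: (1, j, 1)].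
  by rewrite big_seq1 /= mul1r mulr1.
have := @homogeneous_word_rel_word c j (take i t) (drop i t).
rewrite -size_cat cat_take_drop size_tuple.
by rewrite (_ : q.-2.+2 = q)//; have := ltn_ord i; lia.
Qed.

(** An element of the ideal need not be written with homogeneous multipliers;
    expanding them into words, the products of degree other than [q] have no
    degree [q] coordinates. *)
Lemma word_coords_ideal c q x :
  x \in rel_ideal c -> (word_coords q x <= ideal_mx c q)%MS.
Proof.
move=> /rel_idealP[s ->]; rewrite linear_sum summx_sub// => -[[a j] b] _ /=.
rewrite [a]free_alg_word_sum [b]free_alg_word_sum mulr_sum_scale linear_sum.
apply: summx_sub => u _; rewrite linear_sum; apply: summx_sub => v _ /=.
rewrite linearZ scalemx_sub //=.
have [uv|uv] := eqVneq (size u + size v).+2 q; last first.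
  rewrite [X in (X <= _)%MS](_ : _ = 0) ?sub0mx//; apply/rowP => w; rewrite !mxE.
  apply/eqP; apply: contraNT uv.
  have /homogeneousP h := @homogeneous_word_rel_word c j u v.
  by move=> /h <-; rewrite size_tuple.
have [ui uvt] : (size u < q.-1)%N /\ size (u ++ v) == q.-2.
  by rewrite size_cat -uv /=; split=> //; lia.
have := row_ideal_mx c (enum_rank (Ordinal ui, j, Tuple uvt)).
by rewrite enum_rankK /= take_size_cat// drop_size_cat// => <-; apply: row_sub.
Qed.

(** A basis of the quotient comes from a basis of a complement of the row
    space. *)
Lemma has_dim_quad_comp c q :
  has_dim (quad_comp c q) (n ^ q - \rank (ideal_mx c q)).
Proof.
set M := ideal_mx c q; pose B := row_base (M^C)%MS.
have -> : (n ^ q - \rank M)%N = \rank (M^C)%MS.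
  by rewrite mxrank_compl; congr (_ - _)%N; rewrite card_tuple card_ord.
have projZ a (u : F) : a *: quad_proj c u = quad_proj c (a *: u).
  by rewrite -quad_projZ.
have projS (I : Type) (r : seq I) (f : I -> F) :
    \sum_(i <- r) quad_proj c (f i) = quad_proj c (\sum_(i <- r) f i).
  elim: r => [|i r IH]; last by rewrite !big_cons IH quad_projD.
  by rewrite !big_nil /quad_proj !piE.
pose b i := quad_proj c (of_word_coords (row i B)).
have sum_b a : \sum_i a i *: b i =
    quad_proj c (of_word_coords ((\row_i a i) *m B)).
  rewrite mulmx_sum_row linear_sum -projS; apply: eq_bigr => i _.
  by rewrite projZ mxE linearZ.
exists b; split=> [a|].
  rewrite sum_b (_ : 0 = quad_proj c 0); last by rewrite /quad_proj !piE.
  move=> /quad_projP; rewrite subr0 => /(word_coords_ideal q).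
  rewrite of_word_coordsK => aB i.
  have: (\row_i a i *m B <= M :&: M^C)%MS.
    by rewrite sub_capmx aB (submx_trans (submxMl _ _)) ?eq_row_base.
  rewrite capmx_compl submx0 mulmx_free_eq0 ?row_base_free// => /eqP/rowP/(_ i).
  by rewrite !mxE.
apply/seteqP; split=> [_ [x xq <-]|_ [a _ <-]]; last first.
  by rewrite sum_b; eexists; last by []; apply: homogeneous_of_word_coords.
have : (word_coords q x <= M + M^C)%MS by rewrite submx_full// addsmx_compl_full.
move=> /sub_addsmxP[[u v] /= xE].
have : (v *m M^C <= B)%MS by rewrite (submx_trans (submxMl _ _)) ?eq_row_base.
move=> /submxP[w vw]; exists (w 0) => //.
rewrite sum_b -(word_coordsK xq) (_ : \row_i w 0 i = w); last first.
  by apply/rowP => i; rewrite mxE.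
apply/quad_projP; rewrite -linearB; apply: of_word_coords_ideal.
by rewrite xE vw opprD addrCA subrr addr0 -mulNmx submxMl.
Qed.

End HilbertSeries.

(** * Reduction to three rank conditions *)

Section RankCriteria.
Variables (K : fieldType) (n : nat).

(** A linear functional on words of length [q], given by its values [f],
    vanishes on the degree [q] part of the ideal.  Values at words of other
    lengths do not matter, which avoids dependent types in the examples. *)
Definition annihilates d (c : 'I_d * 'I_n * 'I_n -> K) q (f : seq 'I_n -> K) :=
  forall i j t, size t = q.-2 -> (i < q.-1)%N ->
    \sum_x \sum_y c (j, x, y) * f (insert2 i t x y) = 0.

Definition word_values q (f : seq 'I_n -> K) : 'cV[K]_#|{: q.-tuple 'I_n}| :=
  \col_b f (val (enum_val b)).

Lemma ideal_mx_mul_eq0 d (c : 'I_d * 'I_n * 'I_n -> K) q f :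
  annihilates c q f <-> ideal_mx c q *m word_values q f = 0.
Proof.
pose p_of (p : 'I_q.-1 * 'I_d * q.-2.-tuple 'I_n) :=
  \sum_x \sum_y c (p.1.2, x, y) * f (insert2 p.1.1 p.2 x y).
have entry a : (ideal_mx c q *m word_values q f) a 0 = p_of (enum_val a).
  rewrite !mxE /p_of; under eq_bigr do rewrite !mxE mulr_suml.
  rewrite exchange_big; apply: eq_bigr => x _ /=.
  under eq_bigr do rewrite mulr_suml.
  rewrite exchange_big; apply: eq_bigr => y _ /=.
  case: (enum_val a) => [[i j] t] /=.
  have sq : size (insert2 i t x y) == q.
    by apply/eqP; have ip := ltn_ord i; rewrite size_insert2 ?size_tuple; lia.
  rewrite (bigD1 (enum_rank (Tuple sq)))//= enum_rankK /= eqxx mulr1.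
  rewrite big1 ?addr0// => b bi; case: eqP => [bE|]; last by rewrite mulr0 mul0r.
  case/eqP: bi; apply: enum_val_inj; rewrite enum_rankK; exact: val_inj.
split=> [cf|Mf i j t ti iq].
  apply/colP => a; rewrite entry mxE /p_of.
  by case: (enum_val a) => [[i j] t]; apply: cf; rewrite ?size_tuple.
have tP : size t == q.-2 by apply/eqP.
have := entry (enum_rank (Ordinal iq, j, Tuple tP)).
by rewrite Mf mxE enum_rankK.
Qed.

Lemma full_rank_word_values q k (M : 'M[K]_(k, #|{: q.-tuple 'I_n}|)) :
  (n ^ q <= \rank M)%N <->
  forall f, M *m word_values q f = 0 -> forall w, size w = q -> f w = 0.
Proof.
have cardw : #|{: q.-tuple 'I_n}| = (n ^ q)%N by rewrite card_tuple card_ord.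
rewrite -cardw; split=> [rkM f Mf w wq|inj].
  have free : row_free M^T.
    by rewrite /row_free mxrank_tr eqn_leq rank_leq_col rkM.
  have: (word_values q f)^T == 0.
    by rewrite -(mulmx_free_eq0 _ free) -trmx_mul Mf trmx0.
  have wP : size w == q by apply/eqP.
  by move=> /eqP/rowP/(_ (enum_rank (Tuple wP))); rewrite !mxE enum_rankK.
suff: row_free M^T by rewrite /row_free mxrank_tr => /eqP ->.
apply: inj_row_free => v /(congr1 trmx); rewrite trmx_mul trmxK trmx0 => Mv.
pose f s := if insub s is Some w then v 0 (enum_rank (w : q.-tuple 'I_n)) else 0.
have fv : word_values q f = v^T by apply/colP => b; rewrite !mxE /f valK enum_valK.
rewrite -fv in Mv; apply/rowP => b; have /colP/(_ b) := fv; rewrite !mxE => <-.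
by apply: (inj _ Mv); rewrite size_tuple.
Qed.

(** If [k] further linear conditions are enough to kill all annihilating
    functionals, then the rank falls short of the full rank by at most [k]. *)
Lemma rank_ideal_mx_ge d (c : 'I_d * 'I_n * 'I_n -> K) q k
    (X : 'M[K]_(k, #|{: q.-tuple 'I_n}|)) :
  (forall f, annihilates c q f -> X *m word_values q f = 0 ->
    forall w, size w = q -> f w = 0) ->
  (n ^ q <= \rank (ideal_mx c q) + k)%N.
Proof.
move=> inj.
have : (n ^ q <= \rank (col_mx (ideal_mx c q) X))%N.
  apply/full_rank_word_values => f; rewrite mul_col_mx -[0]col_mx0.
  by move=> /eq_col_mx[/ideal_mx_mul_eq0/inj].
move=> /leq_trans; apply; rewrite -addsmxE.
by rewrite (leq_trans (mxrank_adds_leqif _ _))// leq_add2l rank_leq_row.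
Qed.

Lemma rank_ideal_mx_full d (c : 'I_d * 'I_n * 'I_n -> K) q :
  (forall f, annihilates c q f -> forall w, size w = q -> f w = 0) ->
  (n ^ q <= \rank (ideal_mx c q))%N.
Proof.
move=> inj; rewrite -[leqRHS]addn0.
by apply: (@rank_ideal_mx_ge _ c q 0 0) => f /inj.
Qed.

Lemma poly_mx_ideal_mx (T : finType) d q
    (c : (T -> K) -> 'I_d * 'I_n * 'I_n -> K) :
  (forall p, poly_fun (fun v => c v p)) -> poly_mx (fun v => ideal_mx (c v) q).
Proof.
move=> cP a b; set p := enum_val a.
have [P PE] : poly_fun (fun v => \sum_x \sum_y c v (p.1.2, x, y)
    * (val (enum_val b) == insert2 p.1.1 p.2 x y)%:R).
  apply: poly_fun_sum => x _; apply: poly_fun_sum => y _.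
  by apply: poly_funM => //; exact: poly_fun_const.
by exists P => v; rewrite -PE mxE.
Qed.

Lemma word_monom_nil : word_monom K ([::] : seq 'I_n) = 1.
Proof.
by apply: free_algP => s; congr word_coef; rewrite /word_monom -fmoneE.
Qed.

Lemma quad_rel_free_rank d (c : 'I_d * 'I_n * 'I_n -> K) :
  (d <= \rank (ideal_mx c 2))%N -> quad_rel_free c.
Proof.
move=> rk a a0.
have free : row_free (ideal_mx c 2).
  rewrite /row_free eqn_leq rank_leq_row (leq_trans _ rk)//.
  by rewrite !card_prod card_tuple !card_ord expn0 muln1 mul1n.
pose h (j : 'I_d) := enum_rank ((ord0, j, [tuple]) : 'I_2.-1 * 'I_d * 2.-2.-tuple 'I_n).
pose u : 'rV[K]_#|{: 'I_2.-1 * 'I_d * 2.-2.-tuple 'I_n}| := \row_b a (enum_val b).1.2.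
have hbij : bijective h.
  exists (fun b => (enum_val b).1.2) => [j|b]; first by rewrite enum_rankK.
  rewrite /h -[RHS]enum_valK; congr enum_rank.
  by case: (enum_val b) => [[i j] t] /=; rewrite (tuple0 t) (ord1 i).
suff: u = 0 by move=> /rowP u0 j; have := u0 (h j); rewrite !mxE enum_rankK.
apply/eqP; rewrite -(mulmx_free_eq0 _ free) mulmx_sum_row; apply/eqP.
rewrite (reindex h) /=; last exact: onW_bij.
rewrite -[RHS](linear0 (word_coords 2)) -a0 linear_sum; apply: eq_bigr => j _.
have -> : row (h j) (ideal_mx c 2) = word_coords 2 (quad_rel c j).
  have /= -> := @row_ideal_mx _ _ _ c 2 (h j).
  by rewrite enum_rankK /= word_monom_nil mul1r mulr1.
by rewrite linearZ !mxE enum_rankK.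
Qed.

(** Words of length 4 being zero in the algebra, all longer words are. *)
Lemma full_rank_ge d (c : 'I_d * 'I_n * 'I_n -> K) q :
  (n ^ 4 <= \rank (ideal_mx c 4))%N -> (4 <= q)%N ->
  \rank (ideal_mx c q) = (n ^ q)%N.
Proof.
move=> rk4 q4.
have w4 (s : seq 'I_n) : size s = 4 -> word_monom K s \in rel_ideal c.
  move=> s4; have hs : homogeneous 4 (word_monom K s).
    by apply/homogeneousP => s'; rewrite word_coefE; case: (s' =P s) => [->|]; rewrite ?eqxx.
  rewrite -(word_coordsK hs); apply: of_word_coords_ideal; apply: submx_full.
  by rewrite /row_full eqn_leq rank_leq_col (leq_trans _ rk4)// card_tuple card_ord.
suff: row_full (ideal_mx c q) by move=> /eqP ->; rewrite card_tuple card_ord.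
rewrite -sub1mx; apply/row_subP => i; rewrite -[row i _](of_word_coordsK).
apply: word_coords_ideal; apply: rpred_sum => b _; apply: rel_ideal_Z.
rewrite -(cat_take_drop 4 (val _)) word_monom_cat; apply: rel_ideal_Mr.
by apply: w4; rewrite size_takel// size_tuple.
Qed.

Lemma is_hilbert_series_rank (R : realType) d (c : 'I_d * 'I_n * 'I_n -> K) r :
  (d <= n ^ 2)%N -> (d <= \rank (ideal_mx c 2))%N ->
  \rank (ideal_mx c 3) = r -> (n ^ 4 <= \rank (ideal_mx c 4))%N ->
  is_hilbert_series c (ps_of_poly (1 + n%:R *: 'X + (n%:R ^+ 2 - d%:R) *: 'X^2
    + (n%:R ^+ 3 - r%:R) *: 'X^3 : {poly R})).
Proof.
move=> dn rk2 rk3 rk4 q; exists (n ^ q - \rank (ideal_mx c q))%N.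
  exact: has_dim_quad_comp.
rewrite natrB; last first.
  by rewrite (leq_trans (rank_leq_col _))// card_tuple card_ord.
have -> : \rank (ideal_mx c q) = nth (n ^ q)%N [:: 0; 0; d; r]%N q.
  case: q => [|[|[|[|q]]]]; rewrite [RHS]/= //; last by rewrite nth_nil full_rank_ge.
  - apply/eqP; rewrite -leqn0 (leq_trans (rank_leq_row _))//.
    by rewrite !card_prod card_ord.
  - apply/eqP; rewrite -leqn0 (leq_trans (rank_leq_row _))//.
    by rewrite !card_prod card_ord.
  apply/eqP; rewrite eqn_leq rk2 andbT (leq_trans (rank_leq_row _))//.
  by rewrite !card_prod card_tuple !card_ord expn0 muln1 mul1n.
rewrite natrX /ps_of_poly !coefD !coefZ coef1 coefX !coefXn.
case: q => [|[|[|[|q]]]] /=.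
- by rewrite !mulr0 !addr0 subr0 expr0.
- by rewrite !mulr0 !addr0 add0r mulr1 subr0 expr1.
- by rewrite !mulr0 !add0r addr0 mulr1.
- by rewrite !mulr0 !add0r mulr1.
- by rewrite nth_nil natrX subrr !mulr0 !addr0.
Qed.

Lemma generic_hilbert_series (R : realType) d : infinite_set [set: K] ->
  (d <= n ^ 2)%N ->
  (exists c : 'I_d * 'I_n * 'I_n -> K, (d <= \rank (ideal_mx c 2))%N) ->
  (exists c : 'I_d * 'I_n * 'I_n -> K,
    (minn (n ^ 3) (2 * n * d) <= \rank (ideal_mx c 3))%N) ->
  (exists c : 'I_d * 'I_n * 'I_n -> K, (n ^ 4 <= \rank (ideal_mx c 4))%N) ->
  generic_quadratic (fun c : 'I_d * 'I_n * 'I_n -> K =>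
    is_hilbert_series c (ps_of_poly (1 + n%:R *: 'X
      + (n%:R ^+ 2 - d%:R) *: 'X^2
      + Num.max 0 (n%:R ^+ 3 - 2 * n%:R * d%:R) *: 'X^3 : {poly R}))).
Proof.
move=> Kinf dn ex2 ex3 ex4.
pose A q r := [set c : 'I_d * 'I_n * 'I_n -> K | (r <= \rank (ideal_mx c q))%N].
have Ao q r : zariski_open (A q r).
  apply: zariski_open_rank_ge; apply: (poly_mx_ideal_mx (c := id)) => p.
  exact: poly_fun_coord.
exists (A 2 d `&` (A 3 (minn (n ^ 3) (2 * n * d)) `&` A 4 (n ^ 4)%N))%N.
have Uo := zariski_openI (Ao 2 d)
  (zariski_openI (Ao 3 (minn (n ^ 3) (2 * n * d))) (Ao 4 (n ^ 4)))%N.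
split=> // [W W0 Wo|c [c2 [c3 c4]]].
  apply: zariski_open_meet => //.
  apply: zariski_open_meet => //; first exact: zariski_openI.
  exact: zariski_open_meet.
split; first exact: quad_rel_free_rank.
have c3E : \rank (ideal_mx c 3) = minn (n ^ 3) (2 * n * d).
  apply/eqP; rewrite eqn_leq c3 andbT leq_min; apply/andP; split.
    by rewrite (leq_trans (rank_leq_col _))// card_tuple card_ord.
  rewrite (leq_trans (rank_leq_row _))// !card_prod card_tuple !card_ord /=.
  by rewrite expn1 -mulnA [(d * n)%N]mulnC mulnA.
rewrite [X in X *: 'X^3](_ : _ = n%:R ^+ 3 - (minn (n ^ 3) (2 * n * d))%:R).
  exact: is_hilbert_series_rank.
rewrite -!natrM -natrX; case: leqP => le_nd.
  by rewrite subrr; apply/max_idPl; rewrite subr_le0 ler_nat.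
by apply/max_idPr; rewrite subr_ge0 ler_nat ltnW.
Qed.

(** The first [d] monomials of degree 2, for an enumeration of pairs of
    letters. *)
Lemma independent_example d : (d <= n ^ 2)%N ->
  exists c : 'I_d * 'I_n * 'I_n -> K, (d <= \rank (ideal_mx c 2))%N.
Proof.
move=> dn.
have card2 : #|{: 'I_n * 'I_n}| = (n ^ 2)%N by rewrite card_prod card_ord -mulnn.
pose c (p : 'I_d * 'I_n * 'I_n) : K := (enum_rank (p.1.2, p.2) == p.1.1 :> nat)%:R.
exists c.
pose E := 'I_(n ^ 2 - d).
have pos (e : E) : (d + e < #|{: 'I_n * 'I_n}|)%N.
  by rewrite card2; have := ltn_ord e; lia.
pose pt (e : E) : 'I_n * 'I_n := enum_val (Ordinal (pos e)).
pose X : 'M[K]_(n ^ 2 - d, #|{: 2.-tuple 'I_n}|) :=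
  \matrix_(e, b) (val (enum_val b) == [:: (pt e).1; (pt e).2])%:R.
suff: (n ^ 2 <= \rank (ideal_mx c 2) + (n ^ 2 - d))%N by lia.
apply: (rank_ideal_mx_ge (X := X)) => f cf Xf w.
case: w => [|x [|y []]]// _.
have [xyd|xyd] := ltnP (enum_rank (x, y)) d.
  have /= := cf 0 (Ordinal xyd) [::] erefl isT.
  rewrite (bigD1 x)//= (bigD1 y)//= !big1 ?addr0; last 2 first.
  - move=> x' xx'; rewrite big1// => y' _; rewrite /c /= (inj_eq (@ord_inj _)).
    by rewrite (inj_eq enum_rank_inj) xpair_eqE (negbTE xx') mul0r.
  - move=> y' yy'; rewrite /c /= (inj_eq (@ord_inj _)) (inj_eq enum_rank_inj).
    by rewrite xpair_eqE (negbTE yy') andbF mul0r.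
  by rewrite /c /= eqxx mul1r.
have eP : (enum_rank (x, y) - d < n ^ 2 - d)%N.
  by have := ltn_ord (enum_rank (x, y)); rewrite [X in (_ < X)%N]card2; lia.
have /colP/(_ (Ordinal eP)) := Xf; rewrite !mxE.
have ptE : pt (Ordinal eP) = (x, y).
  by apply: enum_rank_inj; rewrite enum_valK; apply/val_inj => /=; rewrite subnKC.
rewrite (bigD1 (enum_rank [tuple x; y]))//= !mxE enum_rankK ptE /= eqxx mul1r.
rewrite big1 ?addr0// => b bxy; rewrite !mxE ptE /=; case: eqP => [bE|]; last by rewrite mul0r.
case/eqP: bxy; apply: enum_val_inj; rewrite enum_rankK; exact: val_inj.
Qed.

End RankCriteria.

(** * Degree 3 *)

Section CubicExample.
Variable K : fieldType.

(** A quadratic relation as a list of terms (coefficient, letter, letter), which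
    can be carried along a renaming of the letters. *)
Definition rel_pairing (A : Type) (r : seq (K * A * A)) (h : A -> A -> K) :=
  \sum_(t <- r) t.1.1 * h t.1.2 t.2.

(** The functional [g] vanishes on [r * u] and on [u * r] for all letters [u]. *)
Definition kills (A : Type) (r : seq (K * A * A)) (g : A -> A -> A -> K) :=
  forall u, rel_pairing r (fun x y => g x y u) = 0 /\ rel_pairing r (g u) = 0.

Section Letters.
Variables (m b : nat).

(** Letters x_i, y_i and, in the odd case [b = 1], one letter z. *)
Definition letter : Type := ((bool * 'I_m) + 'I_b)%type.
HB.instance Definition _ := Finite.on letter.

Definition lx (i : 'I_m) : letter := inl (false, i).
Definition ly (i : 'I_m) : letter := inl (true, i).
Definition lz (k : 'I_b) : letter := inr k.

(** On the span U of x and y, the relations x y and x x - y y already kill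
    degree 3; the indices i, j replace U by its tensor product with a space of
    dimension m.  The letter z satisfies a z = z psi(a) with psi(x) = x + y and
    psi(y) = y, where psi is chosen so that its tensor square maps the relations
    to a complement of them: moving z to the left through a word a a'
    then imposes all the missing conditions on z a a'. *)
Definition cubic_rels : seq (seq (K * letter * letter)) :=
  [seq [:: (1, lx i, ly j)] | i <- enum 'I_m, j <- enum 'I_m] ++
  [seq [:: (1, lx i, lx j); (-1, ly i, ly j)] | i <- enum 'I_m, j <- enum 'I_m] ++
  [seq [:: (1, lx i, lz k); (-1, lz k, lx i); (-1, lz k, ly i)]
     | i <- enum 'I_m, k <- enum 'I_b] ++
  [seq [:: (1, ly i, lz k); (-1, lz k, ly i)] | i <- enum 'I_m, k <- enum 'I_b].

Lemma size_cubic_rels : size cubic_rels = (2 * m * m + 2 * m * b)%N.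
Proof. by rewrite !size_cat !size_allpairs !size_enum_ord; lia. Qed.

(** Each word is rewritten until it becomes a relation.  Without z, this uses
    x x = y y to produce x y.  With one z, the letter is moved to the front,
    and doing so in the relations (a a') z kills z a a'.  With two letters z, both
    are moved to the front. *)
Lemma cubic_rels_kill (g : letter -> letter -> letter -> K) : (b <= 1)%N ->
  (forall r, r \in cubic_rels -> kills r g) ->
  (forall k u, g (lz k) (lz k) u = 0) -> forall p q r, g p q r = 0.
Proof.
move=> b1 kg gzz.
have zE (k k' : 'I_b) : k = k'.
  by apply: ord_inj; have := ltn_ord k; have := ltn_ord k'; lia.
have xy i j u : g (lx i) (ly j) u = 0 /\ g u (lx i) (ly j) = 0.
  have [] := kg [:: (1, lx i, ly j)] _ u.
    by rewrite mem_cat allpairs_f ?mem_enum.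
  by rewrite /rel_pairing !big_seq1 /= !mul1r.
have xx i j u : g (lx i) (lx j) u = g (ly i) (ly j) u /\
    g u (lx i) (lx j) = g u (ly i) (ly j).
  have [] := kg [:: (1, lx i, lx j); (-1, ly i, ly j)] _ u.
    by rewrite 2!mem_cat [X in _ || (X || _)]allpairs_f ?mem_enum ?orbT.
  rewrite /rel_pairing !big_cons !big_nil /= !mul1r !mulN1r !addr0.
  by move=> /subr0_eq -> /subr0_eq ->.
have xz i k u : g (lx i) (lz k) u = g (lz k) (lx i) u + g (lz k) (ly i) u /\
    g u (lx i) (lz k) = g u (lz k) (lx i) + g u (lz k) (ly i).
  have [] := kg [:: (1, lx i, lz k); (-1, lz k, lx i); (-1, lz k, ly i)] _ u.
    by rewrite 3!mem_cat [X in _ || (_ || (X || _))]allpairs_f ?mem_enum ?orbT.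
  rewrite /rel_pairing !big_cons !big_nil /= !mul1r !mulN1r !addr0 -!opprD.
  by move=> /subr0_eq -> /subr0_eq ->.
have yz i k u : g (ly i) (lz k) u = g (lz k) (ly i) u /\
    g u (ly i) (lz k) = g u (lz k) (ly i).
  have [] := kg [:: (1, ly i, lz k); (-1, lz k, ly i)] _ u.
    by rewrite 3!mem_cat [X in _ || (_ || (_ || X))]allpairs_f ?mem_enum ?orbT.
  rewrite /rel_pairing !big_cons !big_nil /= !mul1r !mulN1r !addr0.
  by move=> /subr0_eq -> /subr0_eq ->.
have xyl i j u := (xy i j u).1; have xyr i j u := (xy i j u).2.
have xxl i j u := (xx i j u).1; have xxr i j u := (xx i j u).2.
have xzl i j u := (xz i j u).1; have xzr i j u := (xz i j u).2.
have yzl i j u := (yz i j u).1; have yzr i j u := (yz i j u).2.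
have zyy k i j : g (lz k) (ly i) (ly j) = 0.
  by have := xyl i j (lz k); rewrite yzr xzl xyr add0r.
have zxx k i j : g (lz k) (lx i) (lx j) = 0 by rewrite xxr.
have zyx k i j : g (lz k) (ly i) (lx j) = 0.
  have := xxl i j (lz k); rewrite xzr yzr !xzl yzl xyr !zyy zxx.
  by rewrite !addr0 add0r.
have zAA k p q : g (lz k) (inl p) (inl q) = 0.
  case: p q => [[] i] [[] j]; by [exact: zyy|exact: zyx|exact: xyr|exact: zxx].
have AzA p k q : g (inl p) (lz k) (inl q) = 0.
  by case: p => [[] i]; rewrite ?yzl ?xzl !zAA ?addr0.
have AAz p q k : g (inl p) (inl q) (lz k) = 0.
  by case: q => [[] i]; rewrite ?yzr ?xzr !AzA ?addr0.
have yyy i j k : g (ly i) (ly j) (ly k) = 0 by rewrite -xxl xyr.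
have AAA p q r : g (inl p) (inl q) (inl r) = 0.
  case: p q r => [[] i] [[] j] [[] k]; try by [exact: xyl|exact: xyr|exact: yyy].
  - by rewrite -[LHS]xxl [LHS]xxr xyl.
  - by rewrite [LHS]xxr yyy.
  - by rewrite [LHS]xxr xyl.
have zAz k p k' : g (lz k) (inl p) (lz k') = 0.
  by case: p => [[] i]; rewrite (zE k' k) ?yzr ?xzr !gzz ?addr0.
have Azz p k k' : g (inl p) (lz k) (lz k') = 0.
  by case: p => [[] i]; rewrite ?yzl ?xzl !zAz ?addr0.
move=> [p|k] [q|k'] [r|k''] //; first by rewrite (zE k' k); apply: gzz.
by rewrite (zE k' k); apply: gzz.
Qed.

End Letters.

(** [zs] lists the letter z, if there is one.  The count says that the two-sided
    multiples of the relations, together with the words z z u, are exactly as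
    many as the words of length 3. *)
Lemma cubic_example n : exists (rels : seq (seq (K * 'I_n * 'I_n))) (zs : seq 'I_n),
  [/\ (size zs <= 1)%N, (2 * size rels * n + size zs * n = n ^ 3)%N &
    forall g, (forall r, r \in rels -> kills r g) ->
      (forall z u, z \in zs -> g z z u = 0) -> forall p q r, g p q r = 0].
Proof.
pose m := n./2; pose b : nat := odd n.
have nE : n = (2 * m + b)%N by rewrite /m /b mul2n addnC odd_double_half.
have card_letter : #|{: letter m b}| = n.
  by rewrite card_sum card_prod card_bool !card_ord -nE.
have b1 : (b <= 1)%N by rewrite /b; case: odd.
pose k (l : letter m b) : 'I_n := cast_ord card_letter (enum_rank l).
have ksurj x : exists l, k l = x.
  by exists (enum_val (cast_ord (esym card_letter) x)); rewrite /k enum_valK cast_ordKV.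
pose kt (t : K * letter m b * letter m b) := (t.1.1, k t.1.2, k t.2).
exists [seq map kt r | r <- cubic_rels m b], [seq k (lz m i) | i <- enum 'I_b].
have sz : size [seq k (lz m i) | i <- enum 'I_b] = b.
  by rewrite size_map size_enum_ord.
split; rewrite ?sz//.
  rewrite size_map size_cubic_rels; have bb : (b * b = b)%N by case: (b) b1 => [|[]].
  by move: (m) (b) bb nE => m' b' bb ->; rewrite !expnS expn0; nia.
move=> g kg gz p q r.
have [[lp <-] [[lq <-] [lr <-]]] := (ksurj p, (ksurj q, ksurj r)).
apply: (@cubic_rels_kill m b (fun x y z => g (k x) (k y) (k z))) => // [s sr u|i u].
  have := kg _ (map_f (map kt) sr) (k u).
  by rewrite /rel_pairing !big_map.
by apply: gz; apply: map_f; rewrite mem_enum.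
Qed.

Definition rel_coef n (r : seq (K * 'I_n * 'I_n)) x y :=
  \sum_(t <- r) t.1.1 * ((x == t.1.2) && (y == t.2))%:R.

Lemma sum_rel_coef n (r : seq (K * 'I_n * 'I_n)) h :
  \sum_x \sum_y rel_coef r x y * h x y = rel_pairing r h.
Proof.
under eq_bigr => x _ do under eq_bigr => y _ do rewrite mulr_suml.
under eq_bigr => x _ do rewrite exchange_big.
rewrite exchange_big; apply: eq_bigr => -[[a x] y] _ /=.
rewrite (bigD1 x)//= (bigD1 y)//= !big1 ?addr0; first by rewrite !eqxx mulr1.
- by move=> x' /negPf xx'; rewrite big1// => y' _; rewrite xx' mulr0 mul0r.
- by move=> y' /negPf yy'; rewrite yy' andbF mulr0 mul0r.
Qed.

Lemma kills_annihilates n d (c : 'I_d * 'I_n * 'I_n -> K) f j r :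
  annihilates c 3 f -> (forall x y, c (j, x, y) = rel_coef r x y) ->
  kills r (fun x y z => f [:: x; y; z]).
Proof.
move=> cf cr u; rewrite -!sum_rel_coef; split.
  apply: etrans (cf 0%N j [:: u] erefl isT).
  by apply: eq_bigr => x _; apply: eq_bigr => y _; rewrite cr.
apply: etrans (cf 1%N j [:: u] erefl isT).
by apply: eq_bigr => x _; apply: eq_bigr => y _; rewrite cr.
Qed.

Lemma cubic_rank_example n d : exists c : 'I_d * 'I_n * 'I_n -> K,
  (minn (n ^ 3) (2 * n * d) <= \rank (ideal_mx c 3))%N.
Proof.
have [rels [zs [zs1 sizeE kill]]] := cubic_example n.
pose rels' := rels ++ [seq [:: (1, z, z)] | z <- zs].
have size_rels' : size rels' = (size rels + size zs)%N.
  by rewrite size_cat size_map.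
pose c (p : 'I_d * 'I_n * 'I_n) := rel_coef (nth [::] rels' p.1.1) p.1.2 p.2.
exists c.
(* The relation z z comes last in [rels'], and surplus relations are zero. *)
have [drels|] := leqP d (size rels); last first.
  move=> drels; rewrite geq_min; apply/orP; left.
  apply: rank_ideal_mx_full => f cf.
  have killc r : r \in rels' -> kills r (fun x y z => f [:: x; y; z]).
    move=> rr; have ir : (index r rels' < d)%N.
      by move: rr; rewrite -index_mem size_rels'; lia.
    apply: (kills_annihilates (j := Ordinal ir) cf) => x y.
    by rewrite /c /= nth_index.
  move=> [|x [|y [|z []]]]// _.
  apply: (kill (fun x y z => f [:: x; y; z])) => [r rr|w u wz].
    by apply: killc; rewrite mem_cat rr.
  have [] := killc [:: (1, w, w)] _ u.
    by rewrite mem_cat (map_f (fun z => [:: (1, z, z)]) wz) orbT.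
  by rewrite /rel_pairing big_seq1 mul1r.
rewrite geq_min; apply/orP; right.
(* The rank is estimated by adding back the rows of the [e] omitted relations
   and the words z z u. *)
pose e := (size rels - d)%N.
pose c' (p : 'I_e * 'I_n * 'I_n) := rel_coef (nth [::] rels (d + p.1.1)) p.1.2 p.2.
pose E : 'M[K]_(#|{: 'I_(size zs) * 'I_n}|, #|{: 3.-tuple 'I_n}|) :=
  \matrix_(a, w) let z := tnth (in_tuple zs) (enum_val a).1 in
    (val (enum_val w) == [:: z; z; (enum_val a).2])%:R.
suff: (n ^ 3 <= \rank (ideal_mx c 3)
    + (#|{: 'I_3.-1 * 'I_e * 3.-2.-tuple 'I_n}| + #|{: 'I_(size zs) * 'I_n}|))%N.
  by move: (\rank _) => rk; rewrite !card_prod card_tuple !card_ord /= /e; nia.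
apply: (rank_ideal_mx_ge (X := col_mx (ideal_mx c' 3) E)).
  move=> f cf; rewrite mul_col_mx -[0]col_mx0 => /eq_col_mx[c'f Ef].
  have {}c'f : annihilates c' 3 f by apply/ideal_mx_mul_eq0.
  move=> [|x [|y [|z []]]]// _.
  apply: (kill (fun x y z => f [:: x; y; z])) => [r rr|w u wz].
    have ir : (index r rels < size rels)%N by rewrite index_mem.
    have [id|di] := ltnP (index r rels) d.
      apply: (kills_annihilates (j := Ordinal id) cf) => x' y'.
      by rewrite /c /= nth_cat ir nth_index.
    have ie : (index r rels - d < e)%N by rewrite /e; lia.
    apply: (kills_annihilates (j := Ordinal ie) c'f) => x' y'.
    by rewrite /c' /= subnKC// nth_index.
  have iw : (index w zs < size zs)%N by rewrite index_mem.
  have /colP/(_ (enum_rank (Ordinal iw, u))) := Ef; rewrite !mxE.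
  rewrite (bigD1 (enum_rank [tuple w; w; u]))//= !mxE !enum_rankK /=.
  rewrite (tnth_nth w) /= nth_index// eqxx mul1r big1 ?addr0// => a aw.
  rewrite !mxE !enum_rankK /= (tnth_nth w) /= nth_index//.
  case: eqP => [bE|]; last by rewrite mul0r.
  by case/eqP: aw; apply: enum_val_inj; rewrite enum_rankK; exact: val_inj.
Qed.

End CubicExample.

(** * Degree 4 *)

Section QuarticExample.
Variable K : fieldType.

(** A Vandermonde system is injective on every support of size at most [N],
    wherever that support lies.  The power sums give the values of all
    polynomials of size at most [N], among them one that vanishes at all points
    of [S] but one. *)
Lemma vandermonde_eq0 (A : finType) (tau h : A -> K) (S : {set A}) N :
  (forall e, (e < N)%N -> \sum_a tau a ^+ e * h a = 0) ->
  (forall a, h a != 0 -> a \in S) -> {in S &, injective tau} ->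
  (#|S| <= N)%N -> forall a, h a = 0.
Proof.
move=> hN hS tauS SN a0; apply/eqP/negPn/negP => ha0; have a0S := hS _ ha0.
pose p := \prod_(t <- [seq tau a | a <- enum (S :\ a0)]) ('X - t%:P).
have p_size : (size p <= N)%N.
  rewrite size_prod_XsubC size_map -cardE; apply: leq_trans SN.
  by rewrite (cardsD1 a0 S) a0S.
have: \sum_a p.[tau a] * h a = 0.
  under eq_bigr do rewrite (horner_coef_wide _ p_size) mulr_suml.
  rewrite exchange_big big1// => e _ /=.
  under eq_bigr do rewrite -mulrA.
  by rewrite -mulr_sumr hN ?mulr0.
rewrite (bigD1 a0)//= big1 ?addr0 => [/eqP|a aa0]; last first.
  have [->|/hS aS] := eqVneq (h a) 0; first by rewrite mulr0.
  suff /rootP -> : root p (tau a) by rewrite mul0r.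
  by rewrite root_prod_XsubC; apply: map_f; rewrite mem_enum !inE aa0.
rewrite mulf_eq0 (negbTE ha0) orbF -rootE root_prod_XsubC => /mapP[a].
rewrite mem_enum !inE => /andP[aa0 aS] /(tauS _ _ a0S aS) a0a.
by rewrite a0a eqxx in aa0.
Qed.

Lemma card_ord_geq m s : #|[set i : 'I_m | (s <= i)%N]%SET| = (m - s)%N.
Proof.
rewrite -sum1_card (eq_bigl (fun i : 'I_m => xpredT (val i) && (s <= i)%N)).
  by rewrite -(big_geq_mkord s m xpredT (fun=> 1%N)) sum_nat_const_nat muln1.
by move=> i; rewrite inE.
Qed.

Lemma card_shift_geq m s (p : 'I_m.+1) :
  #|[set q : 'I_m.+1 | (s <= val (q - p)%R)%N]%SET| = (m.+1 - s)%N.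
Proof.
rewrite -(card_ord_geq m.+1 s).
rewrite -[RHS](card_preimset _ (addIr (- p))).
by apply: eq_card => q; rewrite !inE.
Qed.

Lemma card_coshift_geq m s (p : 'I_m.+1) :
  #|[set q : 'I_m.+1 | (s <= val (p - q)%R)%N]%SET| = (m.+1 - s)%N.
Proof.
rewrite -(card_ord_geq m.+1 s).
have inj : injective (fun q => p - q) by move=> q q' /addrI/oppr_inj.
rewrite -[RHS](card_preimset _ inj).
by apply: eq_card => q; rewrite !inE.
Qed.

Lemma infinite_injection (A : finType) : infinite_set [set: K] ->
  exists T : A -> K, injective T.
Proof.
move=> /(infinite_uniq_seq #|A|)[t ut tA].
exists (fun a => nth 0 t (enum_rank a)) => a b /eqP.
have rt (x : A) : (enum_rank x < size t)%N by apply: leq_trans tA.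
by rewrite nth_uniq// => /eqP/ord_inj/enum_rank_inj.
Qed.

Section Colored.
Variables (n d k m s : nat).
Hypothesis K_infinite : infinite_set [set: K].
Variables (col : 'I_n -> 'I_k) (pos : 'I_n -> 'I_m.+1).
Hypothesis col_pos_inj : forall x y, col x = col y -> pos x = pos y -> x = y.

(* [inl (a, b, i)] is the relation number [i] between colours [a] and [b], with
   coefficients that are parameters; [inr (a, p, p')] kills the product of the
   letters of colour [a] at positions [p] and [p'].  The numbers
   are pairs (p, i), naturally so for the monomial relations, where (p, i)
   kills the product of the letters at positions p and p + i. *)
Local Notation shift := ('I_m.+1 * 'I_s)%type.
Local Notation relation := ('I_k * 'I_k * shift + 'I_k * 'I_m.+1 * 'I_m.+1)%type.
Local Notation parameter := ('I_k * 'I_k * shift * ('I_m.+1 * 'I_m.+1))%type.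

Definition colored_coef (g : parameter -> K) (r : relation) (x y : 'I_n) : K :=
  match r with
  | inl (a, b, i) =>
      ((col x == a) && (col y == b))%:R * g (a, b, i, (pos x, pos y))
  | inr (a, p, p') =>
      [&& col x == a, col y == a, pos x == p & pos y == p']%:R
  end.

(** Surplus indices present the zero relation. *)
Definition relation_of (j : 'I_d) : option relation :=
  omap enum_val (insub (val j) : option 'I_#|{: relation}|).

Definition colored_rel (g : parameter -> K) (p : 'I_d * 'I_n * 'I_n) : K :=
  oapp (fun r => colored_coef g r p.1.2 p.2) 0 (relation_of p.1.1).

Lemma poly_fun_colored_rel p : poly_fun (fun g => colored_rel g p).
Proof.
rewrite /colored_rel; case: relation_of => [[[[a b] i]|[[a q] q']]|] /=.
- by apply: poly_funM; [exact: poly_fun_const|exact: poly_fun_coord].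
- exact: poly_fun_const.
- exact: poly_fun_const.
Qed.

(** Each relation involves a single pair of colours, which makes the algebra
    graded by coloured words. *)
Lemma colored_rel_homogeneous g j x y x' y' :
  colored_rel g (j, x, y) != 0 -> colored_rel g (j, x', y') != 0 ->
  col x = col x' /\ col y = col y'.
Proof.
rewrite /colored_rel /=; case: relation_of => [[[[a b] i]|[[a q] q']]|] /=.
- case: (col x =P a) (col y =P b) => [->|?] [->|?]; rewrite ?mul0r ?eqxx// => _.
  by case: (col x' =P a) (col y' =P b) => [->|?] [->|?]; rewrite ?mul0r ?eqxx.
- case: (col x =P a) (col y =P a) => [->|?] [->|?]; rewrite ?eqxx// => _.
  by case: (col x' =P a) (col y' =P a) => [->|?] [->|?]; rewrite ?eqxx.
- by rewrite eqxx.
Qed.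

Definition colored_part (w : seq 'I_k) (f : seq 'I_n -> K) t :=
  if map col t == w then f t else 0.

Lemma annihilates_colored_part g q w f :
  annihilates (colored_rel g) q f -> annihilates (colored_rel g) q (colored_part w f).
Proof.
move=> gf i j t tq iq; case: (pickP [pred z | colored_rel g (j, z.1, z.2) != 0]).
  move=> [x0 y0] /= c0.
  transitivity (\sum_x \sum_y colored_rel g (j, x, y) *
    (if map col (insert2 i t x0 y0) == w then f (insert2 i t x y) else 0)).
    apply: eq_bigr => x _; apply: eq_bigr => y _.
    have [->|cxy] := eqVneq (colored_rel g (j, x, y)) 0; first by rewrite !mul0r.
    have [ex ey] := colored_rel_homogeneous cxy c0.
    by rewrite /colored_part /insert2 !map_cat /= ex ey.
  case: (map col _ == w); first exact: gf.
  by rewrite big1// => x _; rewrite big1// => y _; rewrite mulr0.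
move=> c0; rewrite big1// => x _; rewrite big1// => y _.
by have /negbFE/eqP /= -> := c0 (x, y); rewrite mul0r.
Qed.

(** Adding these rows to [ideal_mx] discards all words not coloured by [w]. *)
Definition off_color (w : seq 'I_k) :
    'M[K]_(#|{: 4.-tuple 'I_n}|, #|{: 4.-tuple 'I_n}|) :=
  \matrix_(a, b) ((a == b) && (map col (enum_val a : 4.-tuple 'I_n) != w))%:R.

Lemma off_color_mul_eq0 w f : off_color w *m word_values 4 f = 0 <->
  forall t, size t = 4 -> map col t != w -> f t = 0.
Proof.
have entry a : (off_color w *m word_values 4 f) a 0 =
    (map col (enum_val a : 4.-tuple 'I_n) != w)%:R * f (enum_val a : 4.-tuple 'I_n).
  rewrite !mxE (bigD1 a)//= !mxE eqxx /= big1 ?addr0// => b ba.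
  by rewrite !mxE eq_sym (negbTE ba) mul0r.
split=> [wf t t4 tw|fw].
  have tP : size t == 4 by apply/eqP.
  have := entry (enum_rank (Tuple tP)).
  by rewrite wf mxE enum_rankK /= tw mul1r => <-.
apply/colP => a; rewrite entry mxE.
have [wa|wa] := boolP (map col _ != w); last by rewrite mul0r.
by rewrite fw ?mulr0// size_tuple.
Qed.

Definition good_color (w : seq 'I_k) : set (parameter -> K) :=
  [set g | (n ^ 4 <= \rank (col_mx (ideal_mx (colored_rel g) 4) (off_color w)))%N].

Lemma good_colorP w g : good_color w g <-> forall f,
  annihilates (colored_rel g) 4 f ->
  (forall t, size t = 4 -> map col t != w -> f t = 0) ->
  forall t, size t = 4 -> f t = 0.
Proof.
rewrite /good_color /= full_rank_word_values; split=> inj f.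
  move=> /ideal_mx_mul_eq0 gf /off_color_mul_eq0 wf; apply: inj.
  by rewrite mul_col_mx gf wf col_mx0.
rewrite mul_col_mx -[0]col_mx0 => /eq_col_mx[gf wf].
by apply: inj; [apply/ideal_mx_mul_eq0|apply/off_color_mul_eq0].
Qed.

Lemma good_color_open w : zariski_open (good_color w).
Proof.
apply: zariski_open_rank_ge => a b; rewrite -[a]splitK.
case: (fintype.split a) => a' /=.
  have [p pE] := @poly_mx_ideal_mx K n _ d 4 colored_rel poly_fun_colored_rel a' b.
  by exists p => g; rewrite col_mxEu pE.
have [p pE] : poly_fun (fun _ : parameter -> K => off_color w a' b).
  exact: poly_fun_const.
by exists p => g; rewrite col_mxEd (pE g).
Qed.

(** By the grading the coloured words can be treated one at a time, and by
    genericity each of them with its own choice of parameters. *)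
Lemma colored_quartic_example :
  (forall w : 4.-tuple 'I_k, good_color w !=set0) ->
  exists c : 'I_d * 'I_n * 'I_n -> K, (n ^ 4 <= \rank (ideal_mx c 4))%N.
Proof.
move=> ne.
have [_ [g gw]] := zariski_open_bigmeet (enum {: 4.-tuple 'I_k}) K_infinite
  (fun w => good_color_open (val w)) ne.
exists (colored_rel g); apply: rank_ideal_mx_full => f gf t t4.
have tP : size (map col t) == 4 by rewrite size_map t4.
have /good_colorP inj : good_color (Tuple tP) g.
  move: gw; rewrite (big_rem (Tuple tP)) ?mem_enum//.
  by case.
have := inj _ (annihilates_colored_part (map col t) gf) _ t t4.
rewrite /colored_part eqxx; apply => t' _ /negPf /= tt'.
by rewrite tt'.
Qed.


Hypothesis card_relation : (#|{: relation}| <= d)%N.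
Hypothesis square_le : ((m.+1 - s) ^ 2 <= m.+1 * s)%N.

Lemma relation_of_surj r : exists j, relation_of j = Some r.
Proof.
exists (widen_ord card_relation (enum_rank r)).
by rewrite /relation_of /= valK /= enum_rankK.
Qed.

Lemma annihilates_relation g f r i t : annihilates (colored_rel g) 4 f ->
  size t = 2 -> (i < 3)%N ->
  \sum_x \sum_y colored_coef g r x y * f (insert2 i t x y) = 0.
Proof.
move=> gf t2 i3; have [j jr] := relation_of_surj r.
apply: etrans (gf i j t t2 i3).
by apply: eq_bigr => x _; apply: eq_bigr => y _; rewrite /colored_rel jr.
Qed.

Lemma letter_eqE x y : (x == y) = (col x == col y) && (pos x == pos y).
Proof.
by apply/eqP/andP => [->|[/eqP ? /eqP ?]]; [rewrite !eqxx|apply: col_pos_inj].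
Qed.

Lemma annihilates_delta g f r i t x y : annihilates (colored_rel g) 4 f ->
  size t = 2 -> (i < 3)%N ->
  (forall x' y', colored_coef g r x' y' = ((x' == x) && (y' == y))%:R) ->
  f (insert2 i t x y) = 0.
Proof.
move=> gf t2 i3 rE; have := annihilates_relation r gf t2 i3.
rewrite (bigD1 x)//= (bigD1 y)//= !big1 ?addr0; first by rewrite rE !eqxx mul1r.
- by move=> x' /negPf xx'; rewrite big1// => y' _; rewrite rE xx' mul0r.
- by move=> y' /negPf yy'; rewrite rE yy' andbF mul0r.
Qed.

Lemma annihilates_same_color g f i t x y : annihilates (colored_rel g) 4 f ->
  size t = 2 -> (i < 3)%N -> col x = col y -> f (insert2 i t x y) = 0.
Proof.
move=> gf t2 i3 xy; apply: (annihilates_delta (r := inr (col x, pos x, pos y)) gf) => //.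
by move=> x' y' /=; rewrite !letter_eqE xy; congr (nat_of_bool _)%:R;
  do !case: eqP.
Qed.

(** The pairs (a, b) and (c, e) carry the monomial relations and (b, c) the
    Vandermonde relations; there is no conflict, even if (a, b) = (c, e). *)
Lemma good_color_proper a b c e : a != b -> b != c -> c != e ->
  good_color [:: a; b; c; e] !=set0.
Proof.
move=> ab bc ce.
have [T Tinj] := @infinite_injection ('I_m.+1 * 'I_m.+1)%type K_infinite.
pose g (p : parameter) : K :=
  let: (a', b', i, (q, q')) := p in
  if (a' == b) && (b' == c) then T (q, q') ^+ enum_rank i
  else ((q == i.1) && (val (q' - q) == i.2))%:R.
exists g; apply/good_colorP => f gf offw t t4.
have [/eqP|tw] := eqVneq (map col t) [:: a; b; c; e]; last exact: offw.
case: t t4 => [|x [|y [|z [|u []]]]]// _ /=.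
rewrite !eqseq_cons => /and5P[/eqP xa /eqP yb /eqP zc /eqP ue _].
have monomial i r x' y' : size r = 2 -> (i < 3)%N ->
    ~~ ((col x' == b) && (col y' == c)) -> (val (pos y' - pos x')%R < s)%N ->
    f (insert2 i r x' y') = 0.
  move=> r2 i3 nbc lts.
  (* This relation is the single word x' y'. *)
  have shiftE (q q' p : 'I_m.+1) : (val (q - p)%R == val (q' - p)%R)%:R = (q == q')%:R :> K.
    by rewrite (inj_eq val_inj) (inj_eq (addIr _)).
  apply: (annihilates_delta
    (r := inl (col x', col y', (pos x', Ordinal lts))) gf) => // x'' y''.
  rewrite /= (negbTE nbc) -natrM mulnb !letter_eqE -!andbA.
  case: (col x'' =P _) => //= _; case: (col y'' =P _) => /= _; rewrite ?andbF//.
  case: (pos x'' =P _) => //= ->.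
  exact: shiftE.
pose h (p : 'I_n * 'I_n) : K :=
  ((col p.1 == b) && (col p.2 == c))%:R * f [:: x; p.1; p.2; u].
(* The pairs y z not yet killed by the monomial relations for x y and z u. *)
pose S : {set 'I_n * 'I_n} := [set p | [&& col p.1 == b, col p.2 == c,
  (s <= val (pos p.1 - pos x)%R)%N & (s <= val (pos u - pos p.2)%R)%N]]%SET.
suff : h (y, z) = 0 by rewrite /h /= yb zc !eqxx mul1r.
apply: (@vandermonde_eq0 _ (fun p => T (pos p.1, pos p.2)) h S (m.+1 * s)).
- have card_shift : #|{: shift}| = (m.+1 * s)%N by rewrite card_prod !card_ord.
  move=> ep; rewrite -card_shift => ltp; pose i0 := Ordinal ltp.
  have := annihilates_relation (inl (b, c, enum_val i0)) gf
    (erefl : size [:: x; u] = 2) (isT : 1 < 3)%N.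
  rewrite pair_big /= => {2}<-; apply: eq_bigr => -[y' z'] _ /=.
  by rewrite /h /= !eqxx enum_valK /= mulrCA mulrA.
- move=> [y' z']; rewrite /h /= => h0; rewrite inE /=.
  have [yb'|] := eqVneq (col y') b; last by move=> nb; rewrite (negbTE nb) mul0r eqxx in h0.
  have [zc'|] := eqVneq (col z') c; last first.
    by move=> nc; rewrite (negbTE nc) andbF mul0r eqxx in h0.
  rewrite yb' zc' !eqxx mul1r /= in h0 *.
  apply/andP; split; rewrite leqNgt; apply: contraNN h0 => lts; apply/eqP.
    apply: (@monomial 0 [:: z'; u] x y') => //.
    by rewrite xa negb_and ab.
  apply: (@monomial 2 [:: x; y'] z' u) => //.
  by rewrite zc' (eq_sym c) negb_and bc.
- move=> [y1 z1] [y2 z2]; rewrite !inE /=.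
  move=> /and4P[/eqP y1b /eqP z1c _ _] /and4P[/eqP y2b /eqP z2c _ _] /Tinj[py pz].
  by congr pair; apply: col_pos_inj => //; congruence.
- apply: leq_trans square_le.
  pose P (p : 'I_n * 'I_n) := (pos p.1, pos p.2).
  rewrite -(card_in_imset (f := P)) => [|[y1 z1] [y2 z2]]; last first.
    rewrite !inE /P /= => /and4P[/eqP y1b /eqP z1c _ _] /and4P[/eqP y2b /eqP z2c _ _] [py pz].
    by congr pair; apply: col_pos_inj => //; congruence.
  rewrite -mulnn -{1}(card_shift_geq s (pos x)) -(card_coshift_geq s (pos u)) -cardsX.
  apply/subset_leq_card/fintype.subsetP => _ /imsetP[[y' z'] + ->].
  by rewrite !inE /= => /and4P[_ _ -> ->].
Qed.

Lemma good_color_nonempty (w : 4.-tuple 'I_k) : good_color w !=set0.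
Proof.
case: w => -[|a [|b [|c [|e []]]]]// w4 /=.
have same_color : (a == b) || (b == c) || (c == e) ->
    good_color [:: a; b; c; e] !=set0.
  move=> eqs; exists (fun=> 0); apply/good_colorP => f gf offw t t4.
  have [/eqP|tw] := eqVneq (map col t) [:: a; b; c; e]; last exact: offw.
  case: t t4 => [|x [|y [|z [|u []]]]]// _ /=.
  rewrite !eqseq_cons => /and5P[/eqP xa /eqP yb /eqP zc /eqP ue _].
  case/orP: eqs => [/orP[]|] /eqP cE.
  - by apply: (@annihilates_same_color _ _ 0 [:: z; u] x y gf) => //; congruence.
  - by apply: (@annihilates_same_color _ _ 1 [:: x; u] y z gf) => //; congruence.
  - by apply: (@annihilates_same_color _ _ 2 [:: x; y] z u gf) => //; congruence.
have [ab|ab] := eqVneq a b; first by apply: same_color; rewrite ab eqxx.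
have [bc|bc] := eqVneq b c; first by apply: same_color; rewrite bc eqxx orbT.
have [ce|ce] := eqVneq c e; first by apply: same_color; rewrite ce eqxx orbT.
exact: good_color_proper.
Qed.

End Colored.

(** The letter number x has colour x %/ m.+1 and position x %% m.+1. *)
Lemma quartic_rank_example n d k m s : infinite_set [set: K] ->
  (n <= k.+1 * m.+1)%N -> ((m.+1 - s) ^ 2 <= m.+1 * s)%N ->
  (k.+1 ^ 2 * (m.+1 * s) + k.+1 * m.+1 ^ 2 <= d)%N ->
  exists c : 'I_d * 'I_n * 'I_n -> K, (n ^ 4 <= \rank (ideal_mx c 4))%N.
Proof.
move=> Kinf nkm sq rd.
pose col (x : 'I_n) : 'I_k.+1 := inord (x %/ m.+1).
pose pos (x : 'I_n) : 'I_m.+1 := inord (x %% m.+1).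
apply: (@colored_quartic_example n d k.+1 m s Kinf col pos) => w.
apply: good_color_nonempty => // [x y cxy pxy|].
  apply: ord_inj; rewrite (divn_eq x m.+1) (divn_eq y m.+1).
  have xk (z : 'I_n) : (z %/ m.+1 < k.+1)%N.
    by rewrite ltn_divLR// (leq_trans (ltn_ord z)).
  move/(congr1 val): cxy; rewrite /= !inordK// => ->.
  by move/(congr1 val): pxy; rewrite /= !inordK ?ltn_pmod// => ->.
rewrite card_sum !card_prod !card_ord; apply: leq_trans rd.
by rewrite !expnS !expn0; nia.
Qed.

End QuarticExample.

(** * Asymptotics *)

Section Asymptotics.
Variable R : realType.

Definition golden_bound : R := (3 - Num.sqrt 5) / 2.

Lemma golden_bound_quad : golden_bound ^+ 2 - 3 * golden_bound + 1 = 0.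
Proof.
have := @sqr_sqrtr R 5 (ler0n _ 5); rewrite /golden_bound expr2 => s5.
by rewrite expr2; field : s5.
Qed.

Lemma golden_bound_itv : 0 < golden_bound < 1.
Proof.
have s0 := sqrtr_ge0 (5 : R); have := @sqr_sqrtr R 5 (ler0n _ 5).
rewrite /golden_bound expr2; move: (Num.sqrt 5) s0 => s s0 s5.
by apply/andP; split; nra.
Qed.

Lemma limn_einf_gap (u : nat -> R) (b : R) :
  (b%:E < limn_einf (fun n => (u n)%:E))%E ->
  exists2 e, 0 < e & \forall n \near \oo, b + e <= u n.
Proof.
rewrite /limn_einf /limn_esup /limf_esup lteNr => /ereal_inf_lt[_ [V Voo <-]].
have : (- (b%:E) = (- b)%:E)%E by [].
move=> -> supV.
have [e e0 he] : exists2 e, 0 < e &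
    (ereal_sup ((fun n => - (u n)%:E) @` V) <= (- (b + e))%:E)%E.
  move: supV; case: ereal_sup => [r| |] //.
  - rewrite lte_fin => rb; exists (- b - r); first by rewrite subr_gt0.
    by rewrite lee_fin; lra.
  - by exists 1 => //; rewrite leNye.
exists e => //; apply: filterS Voo => n Vn.
have /= : ((- (u n)%:E) <= (- (b + e))%:E)%E.
  by apply: le_trans he; apply: ereal_sup_ubound; exists n.
by rewrite lee_fin lerN2.
Qed.

(** [s] is just above [golden_bound * m.+1], so that (m.+1 - s)^2 <= m.+1 * s by
    (1 - b)^2 = b; and [k.+1 >= 4 / e] makes the relations within the colours
    cost at most a quarter of [e * n ^ 2].  The rounding errors are linear
    in [n]. *)
Lemma quartic_parameters (e : R) : 0 < e -> \forall n \near \oo,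
  exists k m s : nat, [/\ (n <= k.+1 * m.+1)%N, ((m.+1 - s) ^ 2 <= m.+1 * s)%N &
    (k.+1 ^ 2 * (m.+1 * s) + k.+1 * m.+1 ^ 2)%:R <= (golden_bound + e) * n%:R ^+ 2].
Proof.
move=> e0; have [b0 b1] := andP golden_bound_itv.
have bq := golden_bound_quad; set b := golden_bound in b0 b1 bq *.
pose k := Num.truncn (4 / e).
have ke : 4 <= k.+1%:R * e.
  by have := truncnS_gt (4 / e); rewrite ltr_pdivrMr// => /ltW.
pose N := Num.truncn (2 * (5 + e) * k.+1%:R / e).
(* [N] is large enough for the errors, about (5 + e) k n, to stay below e n^2 / 2. *)
exists (maxn N.+1 k.+1) => // n /=; rewrite geq_max => /andP[Nn kn].
have nN : 2 * (5 + e) * k.+1%:R <= n%:R * e.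
  rewrite -ler_pdivrMr//; apply/ltW/(lt_le_trans (truncnS_gt _)).
  by rewrite ler_nat.
pose m := (n %/ k.+1)%N; pose s := (Num.truncn (b * m.+1%:R)).+1.
exists k, m, s.
have sb : b * m.+1%:R < s%:R by exact: truncnS_gt.
have sb1 : s%:R <= b * m.+1%:R + 1.
  rewrite /s -natr1 lerD2r truncn_le mulr_ge0 ?ler0n//; exact: ltW.
have m0 : 0 < m.+1%:R :> R by rewrite ltr0n.
have k0 : 1 <= k.+1%:R :> R by rewrite ler1n.
split.
- by rewrite /m mulnC ltnW// ltn_ceil.
- have [ms|sm] := leqP m.+1 s.
    by rewrite (eqP (ms : m.+1 - s == 0)%N).
  rewrite -(ler_nat R) natrX natrM natrB 1?ltnW//.
  have : s%:R < m.+1%:R :> R by rewrite ltr_nat.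
  move: (m.+1%:R : R) (s%:R : R) sb sb1 m0 => M S sb sb1 m0 SM; nra.
have kmn : (k.+1%:R * m.+1%:R : R) <= n%:R + k.+1%:R.
  rewrite -natrM -natrD ler_nat mulnS addnC leq_add2r /m mulnC.
  exact: leq_trunc_div.
have knR : k.+1%:R <= n%:R :> R by rewrite ler_nat.
rewrite natrD !natrM.
move: (k.+1%:R : R) (m.+1%:R : R) (s%:R : R) (n%:R : R) => k' m' s' n'
  in ke nN sb sb1 m0 k0 kmn knR *.
have h1 : k' ^+ 2 * (m' * s') <= b * (k' * m') ^+ 2 + k' * (k' * m').
  have : 0 <= k' ^+ 2 * m' by nra.
  nra.
have h2 : k' * m' ^+ 2 <= e / 4 * (k' * m') ^+ 2.
  have : 0 <= k' * m' ^+ 2 by nra.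
  nra.
have k'0 : 0 <= k' by lra.
have n'0 : 0 <= n' by lra.
have be0 : 0 <= b + e / 4 by lra.
have km0 : 0 <= k' * m' by rewrite mulr_ge0// ltW.
have h3 : (k' * m') ^+ 2 <= (n' + k') ^+ 2.
  by rewrite lerXn2r// ?nnegrE// addr_ge0.
have h4 : k' * (k' * m') <= k' * (n' + k') by exact: ler_wpM2l.
have h5 : (b + e / 4) * (k' * m') ^+ 2 <= (b + e / 4) * (n' + k') ^+ 2.
  exact: ler_wpM2l.
have kn' : k' * k' <= k' * n' by exact: ler_wpM2l.
have h6 : (n' + k') ^+ 2 <= n' ^+ 2 + 3 * k' * n' by rewrite sqrrD; lra.
have h7 : (b + e / 4) * (n' + k') ^+ 2 <= (b + e / 4) * (n' ^+ 2 + 3 * k' * n').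
  exact: ler_wpM2l.
have h9 : (b + e / 4) * (3 * k' * n') <= (1 + e / 4) * (3 * k' * n').
  by apply: ler_wpM2r; [rewrite !mulr_ge0|lra].
have h10 : 2 * (5 + e) * k' * n' <= n' * e * n' by exact: ler_wpM2r.
have h11 : 0 <= e * (k' * n') by rewrite !mulr_ge0// ltW.
have h12 : 0 <= e * n' ^+ 2 by rewrite mulr_ge0 ?sqr_ge0 ?ltW.
lra.
Qed.

Lemma ps_inv_quadratic (n d : R) (k : nat) :
  let a := ps_inv (ps_of_poly (1 - n *: 'X + d *: 'X^2)) in
  [/\ a 0%N = 1, a 1%N = n, a 2%N = n ^+ 2 - d, a 3%N = n ^+ 3 - 2 * n * d &
    a 4%N = n ^+ 4 - 3 * n ^+ 2 * d + d ^+ 2].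
Proof.
set p := 1 - _ + _; move=> a.
have pE i : ps_of_poly p i = nth 0 [:: 1; - n; d] i.
  rewrite /ps_of_poly /p !coefD coefN !coefZ coef1 coefX coefXn.
  by case: i => [|[|[|i]]] /=; rewrite ?nth_nil; ring.
have a0 : a 0%N = 1.
  by rewrite /a ps_invE pE big_ord0 /= invr1 mul1r subr0.
have a1 : a 1%N = n.
  by rewrite /a ps_invE !pE big_ord_recl big_ord0 /= -/a a0 !pE /= invr1; ring.
have a2 : a 2%N = n ^+ 2 - d.
  by rewrite /a ps_invE !pE !big_ord_recl big_ord0 /= !pE /= -/a a0 a1 invr1; ring.
have a3 : a 3%N = n ^+ 3 - 2 * n * d.
  rewrite /a ps_invE !pE !big_ord_recl big_ord0 /= !pE /= -/a.
  by rewrite a0 a1 a2 invr1; ring.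
split=> //.
rewrite /a ps_invE !pE !big_ord_recl big_ord0 /= !pE /= -/a.
by rewrite a0 a1 a2 a3 invr1; ring.
Qed.

Lemma ps_trunc_inv_quadratic (n d : nat) : (0 < n)%N -> (d <= n ^ 2)%N ->
  golden_bound * n%:R ^+ 2 < d%:R ->
  ps_of_poly (1 + n%:R *: 'X + (n%:R ^+ 2 - d%:R) *: 'X^2
    + Num.max 0 (n%:R ^+ 3 - 2 * n%:R * d%:R) *: 'X^3 : {poly R}) =
  ps_trunc (ps_inv (ps_of_poly (1 - n%:R *: 'X + d%:R *: 'X^2 : {poly R}))).
Proof.
move=> n0 dn bd; have [] := ps_inv_quadratic (n%:R : R) d%:R 0.
set a := ps_inv _ => a0 a1 a2 a3 a4.
have a2_ge0 : 0 <= a 2%N by rewrite a2 subr_ge0 -natrX ler_nat.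
have a1_ge0 : 0 <= a 1%N by rewrite a1 ler0n.
have a0_ge0 : 0 <= a 0%N by rewrite a0 ler01.
have a4_lt0 : 0 <= a 3%N -> a 4%N < 0.
  rewrite a3 a4 => a3_ge0; have n0R : 0 < n%:R :> R by rewrite ltr0n.
  have [b0 b1] := andP golden_bound_itv; have bq := golden_bound_quad.
  move: (golden_bound) (n%:R : R) (d%:R : R) b0 b1 bq n0R bd a3_ge0 => b N D.
  move=> b0 b1 bq N0 bd DN.
  have {}DN : 2 * D <= N ^+ 2.
    have : N * (2 * D) <= N * N ^+ 2 by rewrite -exprS; lra.
    by rewrite ler_pM2l.
  have -> : N ^+ 4 - 3 * N ^+ 2 * D + D ^+ 2 =
      (D - b * N ^+ 2) * (D - (3 - b) * N ^+ 2).
    (* b (3 - b) = 1, so b and 3 - b are the roots of 1 - 3 x + x^2. *)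
    have : (b ^+ 2 - 3 * b + 1) * N ^+ 4 = 0 by rewrite bq mul0r.
    lra.
  rewrite pmulr_rlt0 ?subr_gt0// subr_lt0.
  have : 0 < N ^+ 2 by rewrite exprn_gt0.
  nra.
apply/funext => k; rewrite /ps_trunc /ps_of_poly !coefD !coefZ coef1 coefX !coefXn.
case: k => [|[|[|[|k]]]] /=.
- rewrite ifT ?a0; first by ring.
  by apply/forallP => -[[|i]].
- rewrite ifT ?a1; first by ring.
  by apply/forallP => -[[|[|i]]].
- rewrite ifT ?a2; first by ring.
  by apply/forallP => -[[|[|[|i]]]].
- rewrite !mulr0 !add0r mulr1 -a3; case: ifPn => [/forallP/(_ ord_max) /= |].
    by move/max_idPr.
  rewrite negb_forall => /existsP[[[|[|[|[|i]]]] //= _]]; rewrite ?a0_ge0 ?a1_ge0 ?a2_ge0//.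
  by rewrite -ltNge => /ltW/max_idPl.
rewrite !mulr0 !addr0 ifF//; apply/negbTE/negP => /forallP a_ge0.
have le4 i (i4 : (i < 5)%N) : 0 <= a i.
  have ik : (i < k.+4.+1)%N by lia.
  exact: (a_ge0 (Ordinal ik)).
by have := a4_lt0 (le4 3 isT); rewrite ltNge le4.
Qed.

End Asymptotics.

(** * The theorem *)

Theorem corollary1p6 (R : realType) (K : fieldType) (d : nat -> nat)
    (K_infinite : infinite_set [set: K])
    (d_bounds : forall n, (0 < n)%N -> (0 < d n <= n ^ 2)%N)
    (d_liminf : (((3 - Num.sqrt 5) / 2 : R)%:E
                 < limn_einf (fun n => ((d n)%:R / n%:R ^+ 2 : R)%:E))%E) :
  \forall n \near \oo,
    let H := ps_of_poly (1 + n%:R *: 'X + (n%:R ^+ 2 - (d n)%:R) *: 'X^2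
               + Num.max 0 (n%:R ^+ 3 - 2 * n%:R * (d n)%:R) *: 'X^3
               : {poly R}) in
    generic_quadratic
      (fun c : 'I_(d n) * 'I_n * 'I_n -> K => is_hilbert_series c H) /\
    H = ps_trunc (ps_inv
          (ps_of_poly (1 - n%:R *: 'X + (d n)%:R *: 'X^2 : {poly R}))).
Proof.
have [e e0 gap] := limn_einf_gap d_liminf.
near=> n.
have n0 : (0 < n)%N by near: n; exists 1%N.
have /andP[_ dn] := d_bounds n n0.
have n2 : 0 < n%:R ^+ 2 :> R by rewrite exprn_gt0// ltr0n.
have dlow : (golden_bound R + e) * n%:R ^+ 2 <= (d n)%:R.
  by rewrite -ler_pdivlMr//; near: n.
split; last first.
  apply: ps_trunc_inv_quadratic => //; apply: lt_le_trans dlow.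
  by rewrite ltr_pM2r// ltrDl.
apply: generic_hilbert_series => //.
- exact: independent_example.
- exact: cubic_rank_example.
have [k [m [s [nkm sq rd]]]] : exists k m s : nat,
    [/\ (n <= k.+1 * m.+1)%N, ((m.+1 - s) ^ 2 <= m.+1 * s)%N &
    (k.+1 ^ 2 * (m.+1 * s) + k.+1 * m.+1 ^ 2)%:R
      <= (golden_bound R + e) * n%:R ^+ 2].
  by near: n; exact: quartic_parameters.
apply: (quartic_rank_example (k := k) (m := m) (s := s)) => //.
by rewrite -(ler_nat R) (le_trans rd).
Unshelve. all: by end_near.
Qed.
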